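(* Let $k$ be an algebraically closed field and let $Q$ be a Dynkin quiver. Then there are no Ext-nontrivial couples in $\mathrm{Rep}_k(Q)$, i.e. for any two exceptional representations $\rho,\rho'\in \mathrm{Rep}_k(Q)$ we have $\hom^1(\rho,\rho')=0$ or $\hom^1(\rho',\rho)=0$.
   Context: A Dynkin quiver is a quiver (with any orientation of the arrows) whose underlying non-oriented graph is $A_n$ ($n\geq 1$), $D_n$ ($n\geq 4$) or $E_n$ ($n=6,7,8$). $\mathrm{Rep}_k(Q)$ is the category of finite-dimensional $k$-representations of $Q$; $\hom^1(\rho,\rho')=\dim_k\mathrm{Ext}^1(\rho,\rho')$. A representation $\rho$ is exceptional if $\mathrm{Hom}(\rho,\rho)=k$ and $\mathrm{Ext}^1(\rho,\rho)=0$. An Ext-nontrivial couple is a couple $\{\rho,\rho'\}$ of exceptional objects with $\hom^1(\rho,\rho')\neq 0$ and $\hom^1(\rho',\rho)\neq 0$. *)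

(* Defs.v *)
From HB Require Import structures.
From mathcomp Require Import all_boot all_order all_algebra.
From mathcomp Require Import boolp.

Set Implicit Arguments.
Unset Strict Implicit.
Unset Printing Implicit Defensive.

Import GRing.Theory.
Local Open Scope ring_scope.

(* Multiple arrows and loops are allowed. *)
Record quiver := Quiver {
  vertex : finType;
  arrow : finType;
  src : arrow -> vertex;
  tgt : arrow -> vertex }.

(* In the underlying non-oriented multigraph; a loop counts as one edge. *)
Definition nedges (Q : quiver) (x y : vertex Q) : nat :=
  #|[set a : arrow Q | (src a == x) && (tgt a == y)
                    || (src a == y) && (tgt a == x)]|.

Definition undirected (n : nat) (r : nat -> nat -> bool) : rel 'I_n :=
  fun i j => r i j || r j i.

(* A_n : the path 0 - 1 - ... - (n-1). *)
Definition graphA n : rel 'I_n := @undirected n (fun i j => i.+1 == j)%N.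

(* D_n : the path 0 - 1 - ... - (n-2), plus the edge (n-3) - (n-1). *)
Definition graphD n : rel 'I_n :=
  @undirected n (fun i j => (i.+1 == j) && (j < n.-1)
                         || (i == n - 3) && (j == n.-1))%N.

(* E_n : the path 0 - 1 - ... - (n-2), plus the edge 2 - (n-1). *)
Definition graphE n : rel 'I_n :=
  @undirected n (fun i j => (i.+1 == j) && (j < n.-1)
                         || (i == 2) && (j == n.-1))%N.

Variant dynkin_graph : forall n : nat, rel 'I_n -> Prop :=
| DynkinA n of (1 <= n)%N : dynkin_graph (@graphA n)
| DynkinD n of (4 <= n)%N : dynkin_graph (@graphD n)
| DynkinE n of (6 <= n <= 8)%N : dynkin_graph (@graphE n).

(* The boolean [e (f x) (f y)] is coerced to 0 or 1: the underlying graph has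
   no loops and no multiple edges. *)
Definition dynkin (Q : quiver) : Prop :=
  exists (n : nat) (e : rel 'I_n), dynkin_graph e /\
    exists f : vertex Q -> 'I_n, bijective f /\
      forall x y, nedges x y = e (f x) (f y).

Record rep (k : fieldType) (Q : quiver) := Rep {
  space :> vertex Q -> vectType k;
  rmap : forall a : arrow Q, 'Hom(space (src a), space (tgt a)) }.

Record rhom (k : fieldType) (Q : quiver) (V W : rep k Q) := RHom {
  hfun :> forall i : vertex Q, 'Hom(V i, W i);
  hfun_nat : forall a v, hfun (tgt a) (rmap V a v) = rmap W a (hfun (src a) v) }.
Arguments hfun_nat {k Q V W}.

Section Constructions.
Variables (k : fieldType) (Q : quiver).
Implicit Types V W : rep k Q.

Definition dsum_fun (A B C D : vectType k) (f : 'Hom(A, C)) (g : 'Hom(B, D))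
  (u : A * B) : (C * D)%type := (f u.1, g u.2).

Fact dsum_fun_linear (A B C D : vectType k) (f : 'Hom(A, C)) (g : 'Hom(B, D)) :
  linear (@dsum_fun A B C D f g).
Proof. by move=> c u v; rewrite /dsum_fun /= !linearP. Qed.

HB.instance Definition _ (A B C D : vectType k) (f : 'Hom(A, C)) (g : 'Hom(B, D)) :=
  GRing.isLinear.Build k (A * B)%type (C * D)%type *:%R (@dsum_fun A B C D f g)
    (@dsum_fun_linear A B C D f g).

Definition dsum V W : rep k Q :=
  @Rep k Q (fun i => (V i * W i)%type : vectType k)
    (fun a => linfun (dsum_fun (rmap V a) (rmap W a))).

Fact scale_hom_nat V (c : k) a v :
  (c *: \1%VF : 'Hom(V (tgt a), V (tgt a))) (rmap V a v)
  = rmap V a ((c *: \1%VF : 'Hom(V (src a), V (src a))) v).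
Proof. by rewrite !scale_lfunE !id_lfunE linearZ. Qed.
Definition scale_hom V (c : k) : rhom V V :=
  RHom (hfun := fun i => c *: \1%VF) (@scale_hom_nat V c).

Fact id_hom_nat V a v :
  (\1%VF : 'Hom(V (tgt a), V (tgt a))) (rmap V a v)
  = rmap V a ((\1%VF : 'Hom(V (src a), V (src a))) v).
Proof. by rewrite !id_lfunE. Qed.
Definition id_hom V : rhom V V := RHom (hfun := fun i => \1%VF) (@id_hom_nat V).

Fact fst_hom_nat V W a v :
  linfun fst (rmap (dsum V W) a v)
  = rmap V a (linfun fst (v : (V (src a) * W (src a))%type)).
Proof. by rewrite !lfunE. Qed.
Definition fst_hom V W : rhom (dsum V W) V := 
  RHom (V := dsum V W) (hfun := fun i => linfun fst) (@fst_hom_nat V W).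

Fact snd_hom_nat V W a v :
  linfun snd (rmap (dsum V W) a v)
  = rmap W a (linfun snd (v : (V (src a) * W (src a))%type)).
Proof. by rewrite !lfunE. Qed.
Definition snd_hom V W : rhom (dsum V W) W := 
  RHom (V := dsum V W) (hfun := fun i => linfun snd) (@snd_hom_nat V W).

Fact add_hom_nat V W (f g : rhom V W) a v :
  (f (tgt a) + g (tgt a)) (rmap V a v) = rmap W a ((f (src a) + g (src a)) v).
Proof. by rewrite !add_lfunE !hfun_nat linearD. Qed.
Definition add_hom V W (f g : rhom V W) : rhom V W :=
  RHom (hfun := fun i => f i + g i) (@add_hom_nat V W f g).

End Constructions.

(* A short exact sequence 0 -> W -> E -> V -> 0.  Exactness in the category of
   representations is exactness at every vertex. *)
Record extension (k : fieldType) (Q : quiver) (V W : rep k Q) := Extension {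
  mid : rep k Q;
  einj : rhom W mid;
  eprj : rhom mid V;
  einj_mono : forall i, lker (einj i) = 0%VS;
  e_exact : forall i, limg (einj i) = lker (eprj i);
  eprj_epi : forall i, limg (eprj i) = fullv }.

Section Ext.
Variables (k : fieldType) (Q : quiver).
Implicit Types V W : rep k Q.

(* e' is the push-out of e along p, i.e. [e'] = p_* [e]:
     0 -> W  -> E  -> V -> 0
          |p    |g    ||
     0 -> W' -> E' -> V -> 0                                             *)
Definition pushforward V W W' (p : rhom W W')
    (e : extension V W) (e' : extension V W') : Prop :=
  exists g : rhom (mid e) (mid e'),
    (forall i w, g i (einj e i w) = einj e' i (p i w)) /\
    (forall i u, eprj e' i (g i u) = eprj e i u).

Definition ext_equiv V W (e e' : extension V W) : Prop :=
  pushforward (id_hom W) e e'.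

Definition is_ext_scale V W (c : k) (e e' : extension V W) : Prop :=
  pushforward (scale_hom W c) e e'.

(* The Baer sum is nabla_* f, where nabla : W (+) W -> W is the sum map and f
   is the pull-back of e1 (+) e2 along the diagonal of V; f is determined up to
   equivalence by its images e1 and e2 under the two projections W (+) W -> W. *)
Definition is_baer_sum V W (e1 e2 e : extension V W) : Prop :=
  exists f : extension V (dsum W W),
    [/\ pushforward (fst_hom W W) f e1, pushforward (snd_hom W W) f e2
      & pushforward (add_hom (fst_hom W W) (snd_hom W W)) f e].

(* Ext^1(V, W), the k-vector space of equivalence classes of extensions under
   the Baer sum, is isomorphic to k^d. *)
Definition ext1_dim V W (d : nat) : Prop :=
  exists E : 'rV[k]_d -> extension V W,
    [/\ forall e, exists! x, ext_equiv (E x) e,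
        forall x y, is_baer_sum (E x) (E y) (E (x + y))
      & forall c x, is_ext_scale c (E x) (E (c *: x))].

End Ext.

Section Cocycles.
Variables (k : fieldType) (Q : quiver).
Implicit Types V W : rep k Q.

Definition cocycle V W := forall a : arrow Q, 'Hom(V (src a), W (tgt a)).

Definition cobound V W (z : cocycle V W) : Prop :=
  exists h : forall i, 'Hom(V i, W i),
    forall a v, z a v = rmap W a (h _ v) - h _ (rmap V a v).

Definition twist_fun (A B C D : vectType k) (f : 'Hom(A, C)) (g : 'Hom(B, D))
  (z : 'Hom(B, C)) (u : A * B) : (C * D)%type := (f u.1 + z u.2, g u.2).

Fact twist_fun_linear (A B C D : vectType k) (f : 'Hom(A, C)) (g : 'Hom(B, D))
  (z : 'Hom(B, C)) : linear (twist_fun f g z).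
Proof.
move=> c u v; rewrite /twist_fun /= !linearP; congr pair => /=.
by rewrite scalerDr addrACA.
Qed.

HB.instance Definition _ (A B C D : vectType k) (f : 'Hom(A, C)) (g : 'Hom(B, D))
    (z : 'Hom(B, C)) :=
  GRing.isLinear.Build k (A * B)%type (C * D)%type *:%R (twist_fun f g z)
    (twist_fun_linear f g z).

Definition twist V W (z : cocycle V W) : rep k Q :=
  @Rep k Q (fun i => (W i * V i)%type : vectType k)
    (fun a => linfun (twist_fun (rmap W a) (rmap V a) (z a))).

Definition inl_fun (A B : vectType k) (u : A) : (A * B)%type := (u, 0).
Fact inl_fun_linear (A B : vectType k) : linear (@inl_fun A B).
Proof. by move=> c u v; rewrite /inl_fun; congr pair; rewrite /= scaler0 addr0. Qed.
HB.instance Definition _ (A B : vectType k) :=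
  GRing.isLinear.Build k A (A * B)%type *:%R (@inl_fun A B) (@inl_fun_linear A B).

Fact tw_inj_nat V W (z : cocycle V W) a v :
  linfun (@inl_fun (W (tgt a)) (V (tgt a))) (rmap W a v)
  = rmap (twist z) a (linfun (@inl_fun (W (src a)) (V (src a))) v).
Proof.
by rewrite !lfunE /= /twist_fun /inl_fun /= !linear0 addr0.
Qed.
Definition tw_inj V W (z : cocycle V W) : rhom W (twist z) :=
  RHom (W := twist z)
    (hfun := fun i => linfun (@inl_fun (W i) (V i))) (@tw_inj_nat V W z).

Fact tw_prj_nat V W (z : cocycle V W) a v :
  linfun snd (rmap (twist z) a v)
  = rmap V a (linfun snd (v : (W (src a) * V (src a))%type)).
Proof. by rewrite !lfunE. Qed.
Definition tw_prj V W (z : cocycle V W) : rhom (twist z) V :=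
  RHom (V := twist z) (hfun := fun i => linfun snd) (@tw_prj_nat V W z).

Fact tw_mono V W (z : cocycle V W) i : lker (tw_inj z i) = 0%VS.
Proof.
by apply/eqP/lker0P => u v; rewrite !lfunE /= => -[].
Qed.
Fact tw_exact V W (z : cocycle V W) i : limg (tw_inj z i) = lker (tw_prj z i).
Proof.
apply/vspaceP => u; rewrite memv_ker lfunE /=.
apply/memv_imgP/eqP => [[w _ ->]|u2]; first by rewrite lfunE.
by exists u.1; rewrite ?memvf // lfunE /= /inl_fun -u2; case: u {u2}.
Qed.
Fact tw_epi V W (z : cocycle V W) i : limg (tw_prj z i) = fullv.
Proof.
apply/vspaceP => v; rewrite memvf; apply/memv_imgP.
by exists ((0, v) : (W i * V i)%type); rewrite ?memvf // lfunE.
Qed.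
Definition tw_ext V W (z : cocycle V W) : extension V W :=
  Extension (tw_mono z) (tw_exact z) (@tw_epi V W z).

Definition pcocycle V W W' (p : rhom W W') (z : cocycle V W) : cocycle V W' :=
  fun a => (p (tgt a) \o z a)%VF.

Lemma sub_swap (A : zmodType) (x y z t : A) :
  x + y = z + t <-> x - t = z - y.
Proof.
split=> /eqP h; apply/eqP; move: h.
  by rewrite -subr_eq addrAC eq_sym -subr_eq eq_sym.
by rewrite eq_sym subr_eq -addrA (addrC (- t)) addrA eq_sym subr_eq.
Qed.

Lemma lfun_of (A B : vectType k) (f : A -> B) :
  linear f -> {g : 'Hom(A, B) | forall u, g u = f u}.
Proof.
move=> lf; pose F : {linear A -> B} :=
  HB.pack f (GRing.isLinear.Build k A B *:%R f lf).
by exists (linfun F) => u; rewrite lfunE.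
Qed.

Lemma tw_push V W W' (p : rhom W W') (z : cocycle V W) (z' : cocycle V W') :
  pushforward p (tw_ext z) (tw_ext z') <->
  cobound (fun a => pcocycle p z a - z' a).
Proof.
split=> [[g [g1 g2]]|[h hP]].
  have gE i w v : g i ((w, v) : (W i * V i)%type) =
      ((p i w + (g i ((0, v) : (W i * V i)%type)).1, v) : (W' i * V i)%type).
    have -> : ((w, v) : (W i * V i)%type) = ((w, 0) : (W i * V i)%type) + (0, v).
      by congr pair; rewrite /= ?addr0 ?add0r.
    rewrite linearD.
    have := g1 i w; rewrite /= !lfunE /= /inl_fun => ->.
    have := g2 i ((0, v) : (W i * V i)%type); rewrite /= !lfunE /= => e.
    case: (g i ((0, v) : (W i * V i)%type)) e => y1 y2 /= ->.
    by congr pair; rewrite /= add0r.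
  have hl i : linear (fun v : V i => (g i ((0, v) : (W i * V i)%type)).1).
    move=> c u v.
    have -> : ((0, c *: u + v) : (W i * V i)%type) = c *: ((0, u) : (W i * V i)%type) + (0, v).
      by congr pair; rewrite /= scaler0 addr0.
    by rewrite linearP.
  exists (fun i => sval (lfun_of (hl i))) => a v.
  rewrite !(svalP (lfun_of (hl _))).
  have := hfun_nat g a ((0, v) : (W _ * V _)%type).
  rewrite /= !lfunE /= /twist_fun /= linear0 add0r gE.
  move=> [+ _]; rewrite !lfunE /=.
  have -> : (g (src a) ((0, v) : (W _ * V _)%type)).2 = v.
    by have := congr1 snd (gE (src a) 0 v).
  by move/sub_swap.
have gl i : linear (fun u : (W i * V i)%type =>
    (p i u.1 + h i u.2, u.2) : (W' i * V i)%type).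
  move=> c u v; rewrite /= !linearP; congr pair => /=.
  by rewrite scalerDr addrACA.
have gn a v : (sval (lfun_of (gl (tgt a)))) (rmap (twist z) a v)
   = rmap (twist z') a (sval (lfun_of (gl (src a))) v).
  rewrite !(svalP (lfun_of (gl _))) /= !lfunE /= /twist_fun /=.
  congr pair; have := hP a v.2; rewrite !lfunE /= !lfunE /= => e.
  rewrite !linearD /= -[RHS]addrA -hfun_nat -addrA; congr (_ + _).
  by apply/sub_swap.
exists (RHom (V := twist z) (W := twist z')
          (hfun := fun i => sval (lfun_of (gl i))) gn); split=> i u /=.
  rewrite (svalP (lfun_of (gl _))) !lfunE /= /inl_fun /= linear0 addr0 //.
by rewrite !lfunE (svalP (lfun_of (gl _))).
Qed.

Lemma push_comp V W W' W'' (p : rhom W W') (q : rhom W' W'') (r : rhom W W'')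
    (e : extension V W) (e' : extension V W') (e'' : extension V W'') :
  (forall i w, r i w = q i (p i w)) ->
  pushforward p e e' -> pushforward q e' e'' -> pushforward r e e''.
Proof.
move=> rE [g [g1 g2]] [h [h1 h2]].
have gn a v : (h (tgt a) \o g (tgt a))%VF (rmap (mid e) a v)
  = rmap (mid e'') a ((h (src a) \o g (src a))%VF v).
  by rewrite !comp_lfunE !hfun_nat.
exists (RHom (hfun := fun i => (h i \o g i)%VF) gn).
by split=> i u; rewrite /= comp_lfunE ?g1 ?h1 ?rE // h2 g2.
Qed.

Lemma ext_equiv_refl V W (e : extension V W) : ext_equiv e e.
Proof. by exists (id_hom _); split=> i u /=; rewrite !id_lfunE. Qed.

Lemma ext_equiv_trans V W (e1 e2 e3 : extension V W) :
  ext_equiv e1 e2 -> ext_equiv e2 e3 -> ext_equiv e1 e3.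
Proof. by apply: push_comp => i w /=; rewrite !id_lfunE. Qed.

Lemma ext_equiv_sym V W (e e' : extension V W) : ext_equiv e e' -> ext_equiv e' e.
Proof.
case=> g [g1 g2].
have kg i : lker (g i) == 0%VS.
  rewrite -subv0; apply/subvP => u; rewrite memv_ker => /eqP gu.
  have : u \in limg (einj e i) by rewrite e_exact memv_ker -g2 gu linear0.
  case/memv_imgP=> w _ uE; move: gu; rewrite uE g1 /= id_lfunE -(linear0 (einj e' i)).
  have /eqP/lker0P inj' := einj_mono e' i.
  by move/inj' => ->; rewrite linear0 mem0v.
have gK i u : g i ((g i)^-1%VF u) = u.
  apply: limg_lfunVK.
  have : eprj e' i u \in limg (eprj e i) by rewrite eprj_epi memvf.
  case/memv_imgP => x _ xE.
  have : u - g i x \in limg (einj e' i).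
    by rewrite e_exact memv_ker linearB /= g2 xE subrr.
  case/memv_imgP => w _ wE.
  have -> : u = g i (x + einj e i w).
    by rewrite linearD /= g1 /= id_lfunE -wE addrC subrK.
  by rewrite memv_img ?memvf.
have gi i : injective (g i) by apply/lker0P.
have gn a v : (g (tgt a))^-1%VF (rmap (mid e') a v)
  = rmap (mid e) a ((g (src a))^-1%VF v).
  by apply: gi; rewrite hfun_nat !gK.
exists (RHom (hfun := fun i => (g i)^-1%VF) gn); split=> i u /=.
  by apply: gi; rewrite gK g1 /= !id_lfunE.
by rewrite -g2 gK.
Qed.

Lemma tw_ext_onto V W (e : extension V W) :
  exists z : cocycle V W, ext_equiv (tw_ext z) e.
Proof.
pose s i := ((eprj e i)^-1)%VF.
have sK i v : eprj e i (s i v) = v by apply: limg_lfunVK; rewrite eprj_epi memvf.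
pose t i := ((einj e i)^-1)%VF.
have tK i u : eprj e i u = 0 -> einj e i (t i u) = u.
  by move=> u0; apply: limg_lfunVK; rewrite e_exact memv_ker u0.
exists (fun a => t (tgt a) \o ((rmap (mid e) a \o s (src a)) - (s (tgt a) \o rmap V a)))%VF.
set z := fun a => _.
have gl i : linear (fun u : (W i * V i)%type => einj e i u.1 + s i u.2).
  by move=> c u v; rewrite /= !linearP scalerDr addrACA.
have gn a v : (sval (lfun_of (gl (tgt a)))) (rmap (twist z) a v)
   = rmap (mid e) a (sval (lfun_of (gl (src a))) v).
  rewrite !(svalP (lfun_of (gl _))) /= !lfunE /= /twist_fun /=.
  rewrite !linearD /= -hfun_nat -addrA; congr (_ + _).
  rewrite /z comp_lfunE tK !lfunE /= opp_lfunE !comp_lfunE; first by rewrite subrK.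
  by rewrite linearB /= hfun_nat !sK subrr.
exists (RHom (V := twist z) (hfun := fun i => sval (lfun_of (gl i))) gn); split=> i u /=.
  by rewrite (svalP (lfun_of (gl _))) id_lfunE lfunE /= /inl_fun /= linear0 addr0.
rewrite (svalP (lfun_of (gl _))) lfunE /= linearD /= sK.
suff -> : eprj e i (einj e i u.1) = 0 by rewrite add0r.
by apply/eqP; rewrite -memv_ker -e_exact memv_img ?memvf.
Qed.

Lemma cobound0 V W : cobound (fun a => 0 : 'Hom(V (src a), W (tgt a))).
Proof. by exists (fun=> 0) => a v; rewrite !zero_lfunE linear0 subrr. Qed.

Lemma coboundP V W c (z z' : cocycle V W) :
  cobound z -> cobound z' -> cobound (fun a => c *: z a + z' a).
Proof.
move=> [h hP] [h' hP']; exists (fun i => c *: h i + h' i) => a v.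
rewrite !add_lfunE !scale_lfunE hP hP' linearP /=.
by rewrite scalerBr opprD addrACA.
Qed.

Lemma cobound_ext V W (z z' : cocycle V W) :
  (forall a v, z a v = z' a v) -> cobound z -> cobound z'.
Proof. by move=> zz' [h hP]; exists h => a v; rewrite -zz'. Qed.

Lemma tw_equiv V W (z z' : cocycle V W) :
  ext_equiv (tw_ext z) (tw_ext z') <-> cobound (fun a => z a - z' a).
Proof.
rewrite /ext_equiv tw_push; split; apply: cobound_ext => a v;
  by rewrite !add_lfunE comp_lfunE id_lfunE.
Qed.

Lemma tw_push_eq V W W' (p : rhom W W') (z : cocycle V W) (z' : cocycle V W') :
  (forall a v, p (tgt a) (z a v) = z' a v) -> pushforward p (tw_ext z) (tw_ext z').
Proof.
move=> zz'; apply/tw_push; apply: cobound_ext (cobound0 _ _) => a v.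
by rewrite !lfunE /= !lfunE /= zz' subrr.
Qed.

(* p_* is well defined on equivalence classes *)
Lemma push_unique V W W' (p : rhom W W') (z : cocycle V W)
    (f : extension V W) (e : extension V W') :
  ext_equiv (tw_ext z) f -> pushforward p f e ->
  ext_equiv (tw_ext (pcocycle p z)) e.
Proof.
move=> zf fe.
have ze : pushforward p (tw_ext z) e.
  by apply: push_comp zf fe => i w /=; rewrite id_lfunE.
have [z' z'e] := tw_ext_onto e; apply: ext_equiv_trans (z'e).
have /tw_push : pushforward p (tw_ext z) (tw_ext z').
  by apply: push_comp ze (ext_equiv_sym z'e) => i w /=; rewrite id_lfunE.
by move/tw_equiv.
Qed.

Lemma scale_tw V W c (z : cocycle V W) e e' :
  ext_equiv (tw_ext z) e -> is_ext_scale c e e' ->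
  ext_equiv (tw_ext (fun a => c *: z a)) e'.
Proof.
move=> ze /(push_unique ze); congr (ext_equiv (tw_ext _) _).
by apply: functional_extensionality_dep => a; apply/lfunP => v; rewrite !lfunE /= !lfunE /= id_lfunE.
Qed.

Lemma baer_tw V W (z1 z2 : cocycle V W) e1 e2 e :
  ext_equiv (tw_ext z1) e1 -> ext_equiv (tw_ext z2) e2 -> is_baer_sum e1 e2 e ->
  ext_equiv (tw_ext (fun a => z1 a + z2 a)) e.
Proof.
move=> ze1 ze2 [f [f1 f2 f3]]; have [z zf] := tw_ext_onto f.
have /tw_equiv h1 := ext_equiv_trans ze1 (ext_equiv_sym (push_unique zf f1)).
have /tw_equiv h2 := ext_equiv_trans ze2 (ext_equiv_sym (push_unique zf f2)).
apply: ext_equiv_trans (push_unique zf f3); apply/tw_equiv.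
apply: cobound_ext (coboundP 1 h1 h2) => a v.
by do 6 rewrite ?lfunE /=; rewrite scale1r opprD addrACA.
Qed.

Lemma tw_scale V W c (z : cocycle V W) :
  is_ext_scale c (tw_ext z) (tw_ext (fun a => c *: z a)).
Proof. by apply: tw_push_eq => a v /=; rewrite !lfunE /= id_lfunE. Qed.

Lemma tw_baer V W (z1 z2 : cocycle V W) :
  is_baer_sum (tw_ext z1) (tw_ext z2) (tw_ext (fun a => z1 a + z2 a)).
Proof.
have l a : linear (fun v => (z1 a v, z2 a v) : (W (tgt a) * W (tgt a))%type).
  by move=> c u v; rewrite !linearP.
exists (tw_ext (fun a => sval (lfun_of (l a)) : 'Hom(V _, dsum W W _))).
by split; apply: tw_push_eq => a v; rewrite (svalP (lfun_of (l a))) /= !lfunE //= !lfunE.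
Qed.

Lemma lin_pred N (B : 'rV[k]_N -> Prop) :
  B 0 -> (forall c x y, B x -> B y -> B (c *: x + y)) ->
  exists M : 'M[k]_N, forall x, B x <-> (x <= M)%MS.
Proof.
move=> B0 Blin.
pose P r := `[< exists M : 'M[k]_N, (forall i, B (row i M)) /\ \rank M = r >].
have BM m (M : 'M[k]_(m, N)) x : (forall i, B (row i M)) -> (x <= M)%MS -> B x.
  move=> BM /submxP [D ->]; rewrite mulmx_sum_row.
  by elim/big_rec: _ => // i y _; apply: Blin.
have exP : exists r, P r.
  by exists (\rank (0 : 'M[k]_N)); apply/asboolP; exists 0; split=> // i; rewrite row0.
have leP r : P r -> (r <= N)%N.
  by move/asboolP => [M [_ <-]]; apply: rank_leq_row.
case: (ex_maxnP exP leP) => r /asboolP [M [MB Mr]] maxr.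
exists M => x; split=> [Bx|]; last exact: BM.
pose M' := (M + x)%MS.
have M'B i : B (row i M').
  have : (row i M' <= col_mx M x)%MS by rewrite -addsmxE row_sub.
  apply: BM => j; rewrite -[j]splitK; case: (split j) => j' /=.
    by rewrite rowKu.
  by rewrite rowKd row_id.
have : (\rank M' <= \rank M)%N by rewrite Mr maxr //; apply/asboolP; exists M'.
rewrite /M' (geq_leqif (mxrank_leqif_sup (addsmxSl M x))) addsmx_sub => /andP[_ //].
Qed.

Lemma cocycle_coord V W : exists (N : nat) (D : 'rV[k]_N -> cocycle V W),
  (forall c x y a, D (c *: x + y) a = c *: D x a + D y a) /\
  (forall z, exists x, D x = z).
Proof.
pose H (a : arrow Q) : vectType k := 'Hom(V (src a), W (tgt a)).
pose d (a : arrow Q) := \dim (fullv : {vspace H a}).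
pose m := \max_a d a.
have led a : (d a <= m)%N by apply: (leq_bigmax a).
pose b a := vbasis (fullv : {vspace H a}).
pose D (x : 'rV[k]_(#|arrow Q| * m)) : cocycle V W := fun a =>
  \sum_(l < d a) vec_mx x (enum_rank a) (widen_ord (led a) l) *: (b a)`_l.
exists (#|arrow Q| * m)%N, D; split=> [c x y a|z].
  rewrite /D scaler_sumr -big_split /=; apply: eq_bigr => l _.
  by rewrite linearP /= !mxE scalerDl scalerA.
pose F a (l : nat) : k := oapp (fun l : 'I_(d a) => coord (b a) l (z a)) 0 (insub l).
exists (mxvec (\matrix_(j, l) F (enum_val j) l)).
apply: functional_extensionality_dep => a.
rewrite [RHS](coord_vbasis (memvf (z a : H a))); apply: eq_bigr => l _.
by rewrite mxvecK mxE enum_rankK /F /= valK.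
Qed.

Lemma ext1_dim_exists V W : exists d, ext1_dim V W d.
Proof.
have [N [D [Dlin Donto]]] := cocycle_coord V W.
have DB x y a : D (x - y) a = D x a - D y a.
  by rewrite addrC -scaleN1r Dlin scaleN1r addrC.
have DD x y a : D (x + y) a = D x a + D y a.
  by rewrite -[x]scale1r Dlin !scale1r.
have D0 a : D 0 a = 0 by rewrite -(subrr 0) DB subrr.
have DZ c x a : D (c *: x) a = c *: D x a.
  by rewrite -[c *: x]addr0 Dlin D0 addr0.
have [||M MP] := @lin_pred N (fun x => cobound (D x)).
- by apply: cobound_ext (cobound0 V W) => a v; rewrite D0.
- move=> c x y Bx By; apply: cobound_ext (coboundP c Bx By) => a v.
  by rewrite Dlin.
pose R := row_base (M^C)%MS.
exists (\rank (M^C)%MS), (fun y => tw_ext (D (y *m R))).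
have funD (z z' : cocycle V W) : (forall a, z a = z' a) -> z = z'.
  by move=> h; apply: functional_extensionality_dep.
split=> [e|x y|c x].
- have [z ze] := tw_ext_onto e; have [x Dx] := Donto z.
  have : (x <= M + M^C)%MS by rewrite submx_full // addsmx_compl_full.
  case/sub_addsmxP => -[u1 u2] /= xE.
  have : (u2 *m M^C <= R)%MS by rewrite eq_row_base submxMl.
  case/submxP => y yE; exists y; split=> [|y' y'e].
    apply: ext_equiv_trans ze; apply/tw_equiv.
    have : cobound (D (u1 *m M)) by apply/MP; rewrite submxMl.
    move=> h; apply: cobound_ext (coboundP (-1) h (cobound0 V W)) => a v.
    by rewrite -Dx xE yE DD opprD addrCA subrr addr0 addr0 scaleN1r.
  have /tw_equiv := ext_equiv_trans y'e (ext_equiv_sym ze).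
  move=> h.
  have : cobound (D ((y - y') *m R)).
    have h1 : cobound (D (u1 *m M)) by apply/MP; rewrite submxMl.
    apply: cobound_ext (coboundP (-1) h (coboundP (-1) h1 (cobound0 V W))) => a v.
    rewrite mulmxBl DB -yE -Dx xE DD addr0 !scaleN1r opprB.
    by rewrite (addrC (D (u1 *m M) a)) addrAC addrK.
  move/MP => hM; apply/eqP; rewrite -subr_eq0; apply/eqP.
  apply: (row_free_inj (row_base_free (M^C)%MS)); rewrite mul0mx.
  apply/eqP; rewrite -submx0 -(capmx_compl M) sub_capmx hM.
  by rewrite (submx_trans (submxMl _ _)) ?eq_row_base.
- have -> : D ((x + y) *m R) = fun a => D (x *m R) a + D (y *m R) a.
    by apply: funD => a; rewrite mulmxDl DD.
  exact: tw_baer.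
- have -> : D (c *: x *m R) = fun a => c *: D (x *m R) a.
    by apply: funD => a; rewrite -scalemxAl DZ.
  exact: tw_scale.
Qed.

Lemma ext1_dim_le V W d d' : ext1_dim V W d -> ext1_dim V W d' -> (d <= d')%N.
Proof.
move=> [E [Eb ED EZ]] [E' [E'b E'D E'Z]].
have ex x : {y | ext_equiv (E' y) (E x)}.
  by apply: cid; have [y [yP _]] := E'b (E x); exists y.
pose f x := sval (ex x); have fP x : ext_equiv (E' (f x)) (E x) := svalP (ex x).
have funi y y' e : ext_equiv (E' y) e -> ext_equiv (E' y') e -> y = y'.
  by have [y0 [_ u]] := E'b e; move=> /u <- /u <-.
have flin : linear f.
  move=> c x y; apply: (funi _ _ (E (c *: x + y))) => //.
  have [z1 h1] := tw_ext_onto (E' (f x)); have [z2 h2] := tw_ext_onto (E' (f y)).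
  have a1 := baer_tw (scale_tw h1 (E'Z c _)) h2 (E'D _ _).
  have a2 := baer_tw (scale_tw (ext_equiv_trans h1 (fP x)) (EZ c _))
                     (ext_equiv_trans h2 (fP y)) (ED _ _).
  exact: ext_equiv_trans (ext_equiv_sym a1) a2.
have [F FE] := @lfun_of 'rV[k]_d 'rV[k]_d' f flin.
have Finj : lker F == 0%VS.
  apply/lker0P => x y; rewrite !FE => fxy.
  have [x0 [_ u]] := Eb (E' (f x)).
  by rewrite -(u x (ext_equiv_sym (fP x))) (u y) // fxy; apply: ext_equiv_sym.
have := dimvS (subvf (limg F)).
by rewrite limg_dim_eq ?(eqP Finj) ?capv0 // !dimvf /dim /= !mul1n.
Qed.

End Cocycles.

Lemma ext1_dim_unique (k : fieldType) (Q : quiver) (V W : rep k Q) d d' :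
  ext1_dim V W d -> ext1_dim V W d' -> d = d'.
Proof. by move=> h h'; apply/eqP; rewrite eqn_leq !(ext1_dim_le h h', ext1_dim_le h' h). Qed.

(* [ext1_dim_unique] shows that the chosen dimension is the only one. *)
Definition hom1 (k : fieldType) (Q : quiver) (V W : rep k Q) : nat :=
  sval (cid (ext1_dim_exists V W)).

Lemma hom1P (k : fieldType) (Q : quiver) (V W : rep k Q) :
  ext1_dim V W (hom1 V W).
Proof. exact: svalP (cid (ext1_dim_exists V W)). Qed.

(* Hom(V, V) = k : the ring morphism k -> End(V), c |-> c * id, is bijective. *)
Definition exceptional (k : fieldType) (Q : quiver) (V : rep k Q) : Prop :=
  (forall f : rhom V V, exists! c : k, forall i v, f i v = c *: v) /\
  hom1 V V = 0%N.

Definition ext_nontrivial_couple (k : fieldType) (Q : quiver) (V W : rep k Q) :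
    Prop :=
  [/\ exceptional V, exceptional W, hom1 V W <> 0%N & hom1 W V <> 0%N].

(* Main.v *)
Require Import Defs.
From mathcomp Require Import all_boot all_order all_algebra.
From mathcomp Require Import boolp.
From mathcomp Require Import ring lra zify.

(** Write X => Y when X is indecomposable and Ext^1(X, Y) <> 0.  Exceptional
    representations are indecomposable, so an Ext-nontrivial couple V, W is a
    closed walk V => W => V.  The proof shows that a Dynkin quiver admits no
    closed walk X_0 => X_1 => ... => X_n = X_0 at all, by induction on its
    total dimension dim X_0 + ... + dim X_(n-1).

    The Euler form <V, W> = dim Hom(V, W) - dim Ext^1(V, W) is a bilinear
    function of the dimension vectors, and its quadratic form is the Tits form,
    which is positive definite for a Dynkin quiver.  Hence the sum of all
    <X_i, X_j> is positive.  Suppose that there were no nonzero maps between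
    different X_i, and that all nonzero endomorphisms of each X_i were
    injective; then End(X_i) = k, since k is algebraically closed.  So all the
    Hom spaces together would have dimension n, the n arrows of the walk would
    account for at least n dimensions of Ext^1, and the sum would be at most 0.
    So (lemma cyclic_hom) one of two things happens, and each of them yields
    a closed walk of smaller total dimension.

    - There is a nonzero map X_i -> X_j with i <> j.  Let I be an
      indecomposable summand of its image; it is a quotient of X_i and a
      subobject of X_j.  Since Ext^1 is half exact, an arrow X_i => Y gives
      I => Y or I => A => Y, where A is a summand of the kernel of X_i -> I;
      dually at X_j with a summand of the cokernel of I -> X_j.  The stretch of
      the walk from X_i to X_j thus becomes a closed walk at I, in which I
      counts once instead of twice: this is walk_hom.

    - Some X_i has a nonzero endomorphism which is not injective.  A classical
      argument of Ringel then finds A, properly contained in X_i, with A => A: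
      this is nonbrick_self_ext.  It uses that a monomorphism V' -> V induces a
      surjection from Ext^1(V, W) to Ext^1(V', W).

    Extensions are handled throughout as cocycles modulo coboundaries, so
    that Ext^1(V, W) = 0 means that every cocycle is a coboundary.  The Tits
    form is shown to be positive by completing squares along the arms of the
    Dynkin graph, from the free end of each arm towards the branch vertex. *)

Set Implicit Arguments.
Unset Strict Implicit.
Unset Printing Implicit Defensive.

Import Order.TTheory GRing.Theory Num.Theory passmx.
Local Open Scope ring_scope.

(** * Morphisms, subrepresentations and quotients *)

Section Representations.
Variables (k : fieldType) (Q : quiver).
Implicit Types A B C I K T V W X Y : rep k Q.

Lemma rhom_ext V W (f g : rhom V W) : (forall i v, f i v = g i v) -> f = g.
Proof.
case: f g => [f fP] [g gP] /= fg.
have e : f = g.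
  by apply: functional_extensionality_dep => i; apply/lfunP => v; apply: fg.
by move: fP; rewrite e => fP; congr RHom; apply: Prop_irrelevance.
Qed.

Lemma comp_nat V W X (g : rhom W X) (f : rhom V W) a v :
  (g (tgt a) \o f (tgt a))%VF (rmap V a v)
  = rmap X a ((g (src a) \o f (src a))%VF v).
Proof. by rewrite !comp_lfunE !hfun_nat. Qed.
Definition rcomp V W X (g : rhom W X) (f : rhom V W) : rhom V X :=
  RHom (hfun := fun i => (g i \o f i)%VF) (comp_nat g f).

Lemma sub_nat V W (f g : rhom V W) a v :
  (f (tgt a) - g (tgt a)) (rmap V a v)
  = rmap W a ((f (src a) - g (src a)) v).
Proof. by rewrite !add_lfunE !opp_lfunE !hfun_nat linearB. Qed.
Definition rsub V W (f g : rhom V W) : rhom V W :=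
  RHom (hfun := fun i => f i - g i) (sub_nat f g).

Lemma zero_nat V W a v :
  (0 : 'Hom(V (tgt a), W (tgt a))) (rmap V a v)
  = rmap W a ((0 : 'Hom(V (src a), W (src a))) v).
Proof. by rewrite !zero_lfunE linear0. Qed.
Definition rzero V W : rhom V W := RHom (hfun := fun=> 0) (@zero_nat V W).

Lemma rcompE V W X (g : rhom W X) (f : rhom V W) i v : rcomp g f i v = g i (f i v).
Proof. by rewrite /= comp_lfunE. Qed.
Lemma rsubE V W (f g : rhom V W) i v : rsub f g i v = f i v - g i v.
Proof. by rewrite /= add_lfunE opp_lfunE. Qed.
Lemma addE V W (f g : rhom V W) i v : add_hom f g i v = f i v + g i v.
Proof. by rewrite /= add_lfunE. Qed.
Lemma idE V i v : id_hom V i v = v.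
Proof. by rewrite /= id_lfunE. Qed.
Lemma rzeroE V W i v : rzero V W i v = 0.
Proof. by rewrite /= zero_lfunE. Qed.
Definition rhomE := (rcompE, rsubE, addE, idE, rzeroE).

Definition rinj V W (f : rhom V W) := forall i, injective (f i).
Definition rsurj V W (f : rhom V W) := forall i w, exists v, f i v = w.

Lemma inj_lker V W (f : rhom V W) i : rinj f -> lker (f i) == 0%VS.
Proof. by move=> fi; apply/lker0P/fi. Qed.

Lemma surj_limg V W (f : rhom V W) i : rsurj f -> limg (f i) = fullv.
Proof.
move=> fs; apply/vspaceP => w; rewrite memvf; have [v <-] := fs i w.
by rewrite memv_img ?memvf.
Qed.

Lemma injK V W (f : rhom V W) i v : rinj f -> (f i)^-1%VF (f i v) = v.
Proof. by move=> fi; apply: lker0_lfunK; apply: inj_lker. Qed.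

Lemma surjK V W (f : rhom V W) i w : rsurj f -> f i ((f i)^-1%VF w) = w.
Proof. by move=> fs; apply: limg_lfunVK; rewrite surj_limg ?memvf. Qed.

(** Subobjects and quotients are compared by their total dimension; the
    dimension vector itself enters only through the Euler form. *)
Definition rdim V : nat := \sum_i \dim {:V i}.

Lemma inj_dim V W (f : rhom V W) : rinj f -> (rdim V <= rdim W)%N.
Proof.
move=> fi; apply: leq_sum => i _.
by rewrite -(limg_dim_eq (f := f i)) ?dimvS ?subvf // (eqP (inj_lker i fi)) capv0.
Qed.

Lemma surj_dim V W (f : rhom V W) : rsurj f -> (rdim W <= rdim V)%N.
Proof.
move=> fs; apply: leq_sum => i _.
by rewrite -(surj_limg i fs) -(limg_ker_dim (f i) fullv) leq_addl.
Qed.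

Lemma inj_surj V W (f : rhom V W) : rinj f -> rdim V = rdim W -> rsurj f.
Proof.
move=> fi /eqP; rewrite eq_sym => e i w.
have fd j : \dim (limg (f j)) = \dim {:V j}.
  by rewrite limg_dim_eq // (eqP (inj_lker j fi)) capv0.
have le j : (\dim {:V j} <= \dim {:W j})%N by rewrite -fd dimvS ?subvf.
have [_] := leqif_sum (fun j (_ : true) => leqif_eq (le j)).
move: e; rewrite /rdim eq_sym => -> /esym/forallP/(_ i) /= /eqP e.
suff /eqP fe : limg (f i) == fullv.
  have : w \in limg (f i) by rewrite fe memvf.
  by case/memv_imgP => v _ ->; exists v.
by rewrite eqEdim subvf fd /= e.
Qed.

Lemma surj_inj V W (f : rhom V W) : rsurj f -> rdim V = rdim W -> rinj f.
Proof.
move=> fs e i; apply/lker0P; rewrite -dimv_eq0.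
have le j : (\dim {:W j} <= \dim {:V j})%N.
  by rewrite -(surj_limg j fs) -(limg_ker_dim (f j) fullv) leq_addl.
have [_] := leqif_sum (fun j (_ : true) => leqif_eq (le j)).
move/eqP: e; rewrite /rdim eq_sym => -> /esym/forallP/(_ i) /= /eqP.
by rewrite -(surj_limg i fs) -[RHS](limg_ker_dim (f i) fullv) capfv; lia.
Qed.

Lemma rdim0 V : rdim V = 0%N -> forall i (v : V i), v = 0.
Proof.
move=> /eqP; rewrite sum_nat_eq0 => /forallP h i v.
have /eqP := h i; rewrite /= => /eqP; rewrite dimv_eq0 => /eqP e.
by apply/eqP; rewrite -memv0 -e memvf.
Qed.

Lemma rdim_eq0 V : (forall i (v : V i), v = 0) -> rdim V = 0%N.
Proof.
move=> h; apply: big1 => i _; apply/eqP; rewrite dimv_eq0 -subv0.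
by apply/subvP => v _; rewrite (h i v) mem0v.
Qed.

Definition short_exact K X I (m : rhom K X) (p : rhom X I) :=
  [/\ rinj m, rsurj p & forall i x, p i x = 0 <-> exists u, m i u = x].

Lemma exact_dim K X I (m : rhom K X) (p : rhom X I) :
  short_exact m p -> rdim X = (rdim K + rdim I)%N.
Proof.
case=> mi ps ex; rewrite /rdim -big_split; apply: eq_bigr => i _ /=.
rewrite -(limg_ker_dim (p i) fullv) capfv (surj_limg i ps); congr (_ + _)%N.
rewrite -(limg_dim_eq (f := m i) (U := fullv)); last first.
  by rewrite (eqP (inj_lker i mi)) capv0.
congr (\dim _); apply/vspaceP => x; rewrite memv_ker; apply/eqP/memv_imgP.
  by move/ex => [u <-]; exists u; rewrite ?memvf.
by case=> u _ ->; apply/ex; exists u.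
Qed.

Section SubQuotient.
Variables (X : rep k Q) (U : forall i, {vspace X i}).
Hypothesis Ust : forall a v, v \in U (src a) -> rmap X a v \in U (tgt a).

Definition subrep : rep k Q :=
  @Rep k Q (fun i => subvs_of (U i) : vectType k)
    (fun a => linfun (vsproj (U (tgt a))) \o (rmap X a \o linfun vsval))%VF.

Lemma subrep_nat a (v : subrep (src a)) :
  linfun vsval (rmap subrep a v) = rmap X a (linfun vsval v).
Proof. by rewrite /= !comp_lfunE !lfunE /= vsprojK // Ust ?subvsP. Qed.
Definition subrep_in : rhom subrep X :=
  RHom (V := subrep) (hfun := fun i => linfun vsval) subrep_nat.

Lemma subrep_in_inj : rinj subrep_in.
Proof. by move=> i u v; rewrite !lfunE /= => /subvs_inj. Qed.

Lemma subrep_inP i x : (exists u, subrep_in i u = x) <-> x \in U i.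
Proof.
split=> [[u <-]|xU]; first by rewrite lfunE /= subvsP.
by exists (vsproj (U i) x); rewrite lfunE /= vsprojK.
Qed.

(** The quotient X / U is carried by the complements of the U i, so that the
    class of x is represented by x minus its projection to U i. *)
Definition quorep : rep k Q :=
  @Rep k Q (fun i => subvs_of (U i)^C%VS : vectType k)
    (fun a => linfun (vsproj (U (tgt a))^C%VS) \o (\1 - projv (U (tgt a))) \o
              (rmap X a \o linfun vsval))%VF.

Let quo i : 'Hom(X i, quorep i) :=
  (linfun (vsproj (U i)^C%VS) \o (\1 - projv (U i)))%VF.

Let quoE i x : vsval (quo i x) = x - projv (U i) x.
Proof.
by rewrite comp_lfunE lfunE /= add_lfunE opp_lfunE id_lfunE vsprojK ?memv_projC.
Qed.

Let quo0 i x : quo i x = 0 <-> x \in U i.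
Proof.
split=> [e|xU].
  have := quoE x; rewrite e /= => /esym/eqP; rewrite subr_eq0 => /eqP ->.
  by rewrite memv_proj.
by apply: subvs_inj; rewrite quoE projv_id // subrr.
Qed.

Lemma quorep_nat a x : quo (tgt a) (rmap X a x) = rmap quorep a (quo (src a) x).
Proof.
rewrite [RHS]comp_lfunE -/(quo (tgt a)); apply/eqP; rewrite -subr_eq0 -linearB.
apply/eqP/quo0; rewrite comp_lfunE lfunE /= quoE linearB /= opprB addrC subrK.
by rewrite Ust ?memv_proj.
Qed.
Definition quorep_pr : rhom X quorep := RHom (W := quorep) quorep_nat.

Lemma quorep_pr0 i x : quorep_pr i x = 0 <-> x \in U i.
Proof. exact: quo0. Qed.

Lemma quorep_pr_surj : rsurj quorep_pr.
Proof.
move=> i w; exists (vsval w); apply: subvs_inj; rewrite quoE.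
suff -> : projv (U i) (vsval w) = 0 by rewrite subr0.
by apply/eqP; rewrite -memv_ker lker_proj subvsP.
Qed.

End SubQuotient.

Lemma ex_kernel X I (p : rhom X I) : rsurj p ->
  exists K (m : rhom K X), short_exact m p.
Proof.
move=> ps.
have st a v : v \in lker (p (src a)) -> rmap X a v \in lker (p (tgt a)).
  by rewrite !memv_ker hfun_nat => /eqP ->; rewrite linear0.
exists (subrep (fun i => lker (p i))), (subrep_in st); split=> //.
  exact: subrep_in_inj.
by move=> i x; rewrite subrep_inP memv_ker; split=> [->|/eqP].
Qed.

Lemma limg_stable V W (f : rhom V W) a w :
  w \in limg (f (src a)) -> rmap W a w \in limg (f (tgt a)).
Proof. by case/memv_imgP => v _ ->; rewrite -hfun_nat memv_img ?memvf. Qed.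

Lemma ex_cokernel I X (m : rhom I X) : rinj m ->
  exists C (p : rhom X C), short_exact m p.
Proof.
move=> mi; exists (quorep (fun i => limg (m i))), (quorep_pr (@limg_stable _ _ m)).
split=> //; first exact: quorep_pr_surj.
move=> i x; rewrite quorep_pr0; split=> [/memv_imgP [u _ ->]|[u <-]].
  by exists u.
by rewrite memv_img ?memvf.
Qed.

Lemma ex_image V W (f : rhom V W) :
  exists I (e : rhom V I) (m : rhom I W), [/\ rsurj e, rinj m & rcomp m e = f].
Proof.
pose I := subrep (fun i => limg (f i)).
pose m : rhom I W := subrep_in (@limg_stable _ _ f).
have mi : rinj m by apply: subrep_in_inj.
have mf i v : m i ((m i)^-1%VF (f i v)) = f i v.
  apply: limg_lfunVK; have [u <-] : exists u, m i u = f i v.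
    by apply/subrep_inP; rewrite memv_img ?memvf.
  by rewrite memv_img ?memvf.
have en a v : ((m (tgt a))^-1 \o f (tgt a))%VF (rmap V a v)
   = rmap I a (((m (src a))^-1 \o f (src a))%VF v).
  by apply: mi; rewrite hfun_nat !comp_lfunE !mf hfun_nat.
exists I, (RHom (hfun := fun i => ((m i)^-1 \o f i)%VF) en), m; split=> //.
  move=> i w /=; have : m i w \in limg (f i) by rewrite lfunE /= subvsP.
  by case/memv_imgP => v _ e; exists v; apply: mi; rewrite comp_lfunE mf.
by apply: rhom_ext => i v; rewrite rcompE /= comp_lfunE mf.
Qed.

Lemma ex_inverse V W (f : rhom V W) : rinj f -> rsurj f ->
  exists g : rhom W V, rcomp g f = id_hom V.
Proof.
move=> fi fs.
have gn a w : (f (tgt a))^-1%VF (rmap W a w) = rmap V a ((f (src a))^-1%VF w).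
  by apply: fi; rewrite hfun_nat !surjK.
exists (RHom (hfun := fun i => (f i)^-1%VF) gn).
by apply: rhom_ext => i v; rewrite !rhomE /= injK.
Qed.

End Representations.

(** * Vanishing of Ext^1 through cocycles *)

Section Ext.
Variables (k : fieldType) (Q : quiver).
Implicit Types A B C I K T V W X Y : rep k Q.

Definition ext0 V W : Prop := forall z : cocycle V W, cobound z.

(** If all extensions are equivalent, their coordinate space has a single
    point. *)
Lemma ext0_hom1 V W : ext0 V W -> hom1 V W = 0%N.
Proof.
move=> h; have := hom1P V W; case: (hom1 V W) => // d [E [Eb _ _]].
have eqE (x y : 'rV_d.+1) : ext_equiv (E x) (E y).
  have [z zx] := tw_ext_onto (E x); have [t ty] := tw_ext_onto (E y).
  apply: ext_equiv_trans (ext_equiv_sym zx) _; apply: ext_equiv_trans ty.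
  by apply/tw_equiv; apply: h.
have [x0 [_ u]] := Eb (E 0).
have := u 0 (ext_equiv_refl _); rewrite (u (const_mx 1) (eqE _ _)).
by move/rowP/(_ 0); rewrite !mxE => /eqP; rewrite oner_eq0.
Qed.

(** A cocycle on V' extends to V along linear retractions of m, with no
    compatibility to check because a quiver has no relations. This is where
    heredity enters: Ext^1 turns monomorphisms in its first argument into
    surjections. *)
Lemma ext0_sub V V' W (m : rhom V' V) : rinj m -> ext0 V W -> ext0 V' W.
Proof.
move=> mi h z; have [g gP] := h (fun a => z a \o (m (src a))^-1)%VF.
exists (fun i => g i \o m i)%VF => a v.
by have := gP a (m _ v); rewrite !comp_lfunE injK // hfun_nat.
Qed.

Lemma sub_cross (G : zmodType) (a b c d : G) : a - b = c - d -> b - d = a - c.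
Proof. by move=> e; rewrite -[a](subrK b) e addrAC [c - d]addrC addrK addrC. Qed.

Section ShortExact.
Variables (K X I : rep k Q) (m : rhom K X) (p : rhom X I).
Hypothesis mp : short_exact m p.

Let mi : rinj m. Proof. by case: mp. Qed.
Let ps : rsurj p. Proof. by case: mp. Qed.
Let pm0 i u : p i (m i u) = 0. Proof. by case: mp => _ _ ->; exists u. Qed.
Let mK i x : p i x = 0 -> m i ((m i)^-1%VF x) = x.
Proof. by case: mp => _ _ ex /ex [u <-]; rewrite injK. Qed.
Let lift_p i x : p i (x - (p i)^-1%VF (p i x)) = 0.
Proof. by rewrite linearB /= surjK // subrr. Qed.

(** The linear section of p need not commute with the arrows; it can still be
    used to descend maps that vanish on K. *)
Lemma factor_p (Y : vectType k) i (f : 'Hom(X i, Y)) : (forall u, f (m i u) = 0) ->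
  forall x, f ((p i)^-1%VF (p i x)) = f x.
Proof.
move=> f0 x; apply/eqP; rewrite eq_sym -subr_eq0 -linearB.
by rewrite -(mK (lift_p x)) /= f0.
Qed.

(** Half exactness in the second argument. Push a cocycle to I, where it
    bounds; lifting the primitive linearly to X and subtracting its coboundary
    leaves a cocycle with values in K. *)
Lemma ext0_midr V : ext0 V K -> ext0 V I -> ext0 V X.
Proof.
move=> hK hI z; have [g gP] := hI (fun a => p _ \o z a)%VF.
pose g' i := ((p i)^-1 \o g i)%VF.
have pg' i v : p i (g' i v) = g i v by rewrite comp_lfunE surjK.
pose z' : cocycle V X := fun a => z a - ((rmap X a \o g' _) - (g' _ \o rmap V a))%VF.
have z'E a v : z' a v = z a v - (rmap X a (g' _ v) - g' _ (rmap V a v)).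
  by rewrite !(add_lfunE, opp_lfunE, comp_lfunE).
have z'0 a v : p _ (z' a v) = 0.
  have := gP a v; rewrite comp_lfunE z'E !linearB /= => ->.
  by rewrite hfun_nat !pg' -opprD subrr.
have [t tP] := hK (fun a => (m _)^-1 \o z' a)%VF.
exists (fun i => g' i + (m i \o t i))%VF => a v.
have /(congr1 (m _)) := tP a v; rewrite comp_lfunE mK // linearB /= hfun_nat z'E.
move/eqP; rewrite subr_eq => /eqP ->; rewrite !add_lfunE !comp_lfunE linearD /=.
by rewrite opprD [RHS]addrACA [RHS]addrC.
Qed.

(** Half exactness in the first argument: the same correction, made by
    extending to X a primitive over K. *)
Lemma ext0_midl W : ext0 K W -> ext0 I W -> ext0 X W.
Proof.
move=> hK hI z; have [g gP] := hK (fun a => z a \o m _)%VF.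
pose g' i := (g i \o (m i)^-1)%VF.
have g'm i u : g' i (m i u) = g i u by rewrite comp_lfunE injK.
pose z' : cocycle X W := fun a => z a - ((rmap W a \o g' _) - (g' _ \o rmap X a))%VF.
have z'E a x : z' a x = z a x - (rmap W a (g' _ x) - g' _ (rmap X a x)).
  by rewrite !(add_lfunE, opp_lfunE, comp_lfunE).
have z'0 a u : z' a (m _ u) = 0.
  by have := gP a u; rewrite comp_lfunE z'E -hfun_nat !g'm => ->; rewrite subrr.
have [t tP] := hI (fun a => z' a \o (p _)^-1)%VF.
exists (fun i => g' i + (t i \o p i))%VF => a x.
have := tP a (p _ x); rewrite comp_lfunE (factor_p (z'0 a)) z'E -hfun_nat.
move/eqP; rewrite subr_eq => /eqP ->; rewrite !add_lfunE !comp_lfunE linearD /=.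
by rewrite opprD [RHS]addrACA [RHS]addrC.
Qed.

(** The obstruction to extending f to X is the class of the pushout of
    0 -> K -> X -> I -> 0 along f. Concretely, the failure of a linear extension to
    commute with the arrows is a cocycle that descends to I. *)
Lemma ext0_extend T (f : rhom K T) : ext0 I T ->
  exists g : rhom X T, rcomp g m = f.
Proof.
move=> h; pose f' i := (f i \o (m i)^-1)%VF.
have f'm i u : f' i (m i u) = f i u by rewrite comp_lfunE injK.
pose z a := ((rmap T a \o f' _) - (f' _ \o rmap X a))%VF.
have zE a x : z a x = rmap T a (f' _ x) - f' _ (rmap X a x).
  by rewrite !(add_lfunE, opp_lfunE, comp_lfunE).
have z0 a u : z a (m _ u) = 0 by rewrite zE -hfun_nat !f'm hfun_nat subrr.
have [t tP] := h (fun a => z a \o (p _)^-1)%VF.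
have gn a x : (f' (tgt a) - (t (tgt a) \o p (tgt a)))%VF (rmap X a x)
    = rmap T a ((f' (src a) - (t (src a) \o p (src a)))%VF x).
  have := tP a (p _ x); rewrite comp_lfunE (factor_p (z0 a)) zE -hfun_nat.
  by move/sub_cross; rewrite !(add_lfunE, opp_lfunE, comp_lfunE) linearB.
exists (RHom (hfun := fun i => f' i - (t i \o p i))%VF gn); apply: rhom_ext => i u.
by rewrite rcompE /= add_lfunE opp_lfunE comp_lfunE f'm pm0 linear0 subr0.
Qed.

(** Dual of [ext0_extend]: the obstruction is the pullback of the sequence
    along f. *)
Lemma ext0_lift T (f : rhom T I) : ext0 T K ->
  exists g : rhom T X, rcomp p g = f.
Proof.
move=> h; pose f' i := ((p i)^-1 \o f i)%VF.
have pf' i u : p i (f' i u) = f i u by rewrite comp_lfunE surjK.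
pose z a := ((rmap X a \o f' _) - (f' _ \o rmap T a))%VF.
have zE a v : z a v = rmap X a (f' _ v) - f' _ (rmap T a v).
  by rewrite !(add_lfunE, opp_lfunE, comp_lfunE).
have z0 a v : p _ (z a v) = 0 by rewrite zE linearB /= hfun_nat !pf' hfun_nat subrr.
have [t tP] := h (fun a => (m _)^-1 \o z a)%VF.
have gn a v : (f' (tgt a) - (m (tgt a) \o t (tgt a)))%VF (rmap T a v)
    = rmap X a ((f' (src a) - (m (src a) \o t (src a)))%VF v).
  have /(congr1 (m _)) := tP a v; rewrite comp_lfunE mK // linearB /= hfun_nat zE.
  by move/sub_cross; rewrite !(add_lfunE, opp_lfunE, comp_lfunE) linearB.
exists (RHom (hfun := fun i => f' i - (m i \o t i))%VF gn); apply: rhom_ext => i u.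
by rewrite rcompE /= add_lfunE opp_lfunE comp_lfunE linearB /= pm0 pf' subr0.
Qed.

End ShortExact.
End Ext.

(** * Indecomposable summands *)

Section Indecomposables.
Variables (k : fieldType) (Q : quiver).
Implicit Types A B C I K T V W X Y : rep k Q.

Lemma factor_kernel K X I (m : rhom K X) (p : rhom X I) T (f : rhom T X) :
  short_exact m p -> rcomp p f = rzero T I -> exists g : rhom T K, rcomp m g = f.
Proof.
case=> mi _ ex pf0.
have mf i v : m i ((m i)^-1%VF (f i v)) = f i v.
  have /ex [u <-] : p i (f i v) = 0 by rewrite -rcompE pf0 rzeroE.
  by rewrite injK.
have gn a v : ((m (tgt a))^-1 \o f (tgt a))%VF (rmap T a v)
   = rmap K a (((m (src a))^-1 \o f (src a))%VF v).
  by apply: mi; rewrite hfun_nat !comp_lfunE !mf hfun_nat.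
exists (RHom (hfun := fun i => ((m i)^-1 \o f i)%VF) gn).
by apply: rhom_ext => i v; rewrite rcompE /= comp_lfunE mf.
Qed.

Lemma retractK A X (i : rhom A X) (p : rhom X A) :
  rcomp p i = id_hom A -> forall v x, p v (i v x) = x.
Proof. by move=> pi v x; rewrite -rcompE pi idE. Qed.

Lemma retract_rinj A X (i : rhom A X) (p : rhom X A) :
  rcomp p i = id_hom A -> rinj i.
Proof. by move=> /retractK pi v; apply: can_inj (pi v). Qed.

Lemma retract_rsurj A X (i : rhom A X) (p : rhom X A) :
  rcomp p i = id_hom A -> rsurj p.
Proof. by move=> /retractK pi v x; exists (i v x). Qed.

Lemma rinj_comp V W X (g : rhom W X) (f : rhom V W) :
  rinj g -> rinj f -> rinj (rcomp g f).
Proof. by move=> gi fi i u v; rewrite !rcompE => /gi /fi. Qed.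

Lemma rsurj_comp V W X (g : rhom W X) (f : rhom V W) :
  rsurj g -> rsurj f -> rsurj (rcomp g f).
Proof.
move=> gs fs i x; have [w <-] := gs i x; have [v <-] := fs i w.
by exists v; rewrite rcompE.
Qed.

Lemma rdim_gt0 V W (f : rhom V W) : f <> rzero V W -> (0 < rdim V)%N.
Proof.
move=> f0; rewrite lt0n; apply/eqP => V0; apply: f0; apply: rhom_ext => i v.
by rewrite (rdim0 V0 v) !linear0.
Qed.

(** Indecomposability through retracts: a nonzero retract A of X is isomorphic
    to X, and equality of dimensions says so, since the section A -> X is
    injective. *)
Definition indec X : Prop := (0 < rdim X)%N /\
  forall A (i : rhom A X) (p : rhom X A),
    rcomp p i = id_hom A -> (0 < rdim A)%N -> rdim A = rdim X.

Lemma indec_split X : (0 < rdim X)%N -> ~ indec X ->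
  exists B (j : rhom B X) (q : rhom X B) C (m : rhom C X) (r : rhom X C),
    [/\ rcomp q j = id_hom B, rcomp r m = id_hom C,
        add_hom (rcomp j q) (rcomp m r) = id_hom X,
        (rdim B < rdim X)%N & (rdim C < rdim X)%N].
Proof.
move=> X0 nX.
have [B [j [q [qj B0 BX]]]] : exists B (j : rhom B X) (q : rhom X B),
    [/\ rcomp q j = id_hom B, (0 < rdim B)%N & rdim B <> rdim X].
  apply: contrapT => h; apply: nX; split=> // A i p pi A0; apply: contrapT => AX.
  by apply: h; exists A, i, p.
have [C [m mq]] := ex_kernel (retract_rsurj qj).
have [r mr] : exists r, rcomp m r = rsub (id_hom X) (rcomp j q).
  apply: factor_kernel mq _; apply: rhom_ext => i x.
  by rewrite !rhomE linearB /= (retractK qj) subrr.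
have mrE i x : m i (r i x) = x - j i (q i x) by rewrite -rcompE mr !rhomE.
case: (mq) => mi _ ex.
exists B, j, q, C, m, r; split=> //.
- apply: rhom_ext => i x; apply: mi; rewrite !rhomE mrE.
  have /ex -> : exists u, m i u = m i x by exists x.
  by rewrite linear0 subr0.
- by apply: rhom_ext => i x; rewrite !rhomE mrE addrC subrK.
- by have := inj_dim (retract_rinj qj); lia.
- by rewrite (exact_dim mq); lia.
Qed.

(** This is the decomposition into indecomposables, phrased without a family
    of summands: the identity of W is a sum of idempotents with indecomposable
    images, so it has every additive property that these have. *)
Lemma summand_ind W (P : rhom W W -> Prop) :
  P (rzero W W) ->
  (forall f g, P f -> P g -> P (add_hom f g)) ->
  (forall A (i : rhom A W) (p : rhom W A),
     rcomp p i = id_hom A -> indec A -> P (rcomp i p)) ->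
  P (id_hom W).
Proof.
move=> P0 PD Pi.
suff H n A (i : rhom A W) (p : rhom W A) :
    (rdim A <= n)%N -> rcomp p i = id_hom A -> P (rcomp i p).
  have -> : id_hom W = rcomp (id_hom W) (id_hom W).
    by apply: rhom_ext => i v; rewrite !rhomE.
  by apply: H (leqnn _) _; apply: rhom_ext => i v; rewrite !rhomE.
elim: n => [|n IHn] in A i p *.
  rewrite leqn0 => /eqP A0 _; have -> // : rcomp i p = rzero W W.
  by apply: rhom_ext => v x; rewrite !rhomE (rdim0 A0 (p v x)) linear0.
move=> An pi; have [iA|niA] := pselect (indec A); first exact: Pi.
have [A0|A0] := posnP (rdim A); first by apply: IHn => //; rewrite A0.
have [B [j [q [C [m [r [qj rm jqmr BA CA]]]]]]] := indec_split A0 niA.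
have -> : rcomp i p = add_hom (rcomp (rcomp i j) (rcomp q p))
                              (rcomp (rcomp i m) (rcomp r p)).
  apply: rhom_ext => v x; rewrite !rhomE -linearD; congr (i v _).
  by rewrite -[LHS]idE -jqmr !rhomE.
apply: PD; apply: IHn; try lia.
  by apply: rhom_ext => v x; rewrite !rhomE (retractK pi) (retractK qj).
by apply: rhom_ext => v x; rewrite !rhomE (retractK pi) (retractK rm).
Qed.

Lemma ext_summandr V W : ~ ext0 V W ->
  exists A (i : rhom A W) (p : rhom W A),
    [/\ rcomp p i = id_hom A, indec A & ~ ext0 V A].
Proof.
move=> nVW; apply: contrapT => nA; apply: nVW => z.
pose P (f : rhom W W) := cobound (fun a => f _ \o z a)%VF.
suff : P (id_hom W) by apply: cobound_ext => a v; rewrite comp_lfunE idE.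
apply: summand_ind => [|f g Pf Pg|A i p pi iA].
- by apply: cobound_ext (cobound0 V W) => a v; rewrite comp_lfunE rzeroE zero_lfunE.
- apply: cobound_ext (coboundP 1 Pf Pg) => a v.
  by rewrite scale1r add_lfunE !comp_lfunE addE.
have VA : ext0 V A by apply: contrapT => nVA; apply: nA; exists A, i, p.
have [h hP] := VA (fun a => p _ \o z a)%VF.
exists (fun v => i v \o h v)%VF => a v; have := hP a v.
by rewrite !comp_lfunE => ->; rewrite linearB /= hfun_nat.
Qed.

Lemma ext_summandl V W : ~ ext0 V W ->
  exists A (i : rhom A V) (p : rhom V A),
    [/\ rcomp p i = id_hom A, indec A & ~ ext0 A W].
Proof.
move=> nVW; apply: contrapT => nA; apply: nVW => z.
pose P (f : rhom V V) := cobound (fun a => z a \o f _)%VF.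
suff : P (id_hom V) by apply: cobound_ext => a v; rewrite comp_lfunE idE.
apply: summand_ind => [|f g Pf Pg|A i p pi iA].
- apply: cobound_ext (cobound0 V W) => a v.
  by rewrite comp_lfunE rzeroE zero_lfunE linear0.
- apply: cobound_ext (coboundP 1 Pf Pg) => a v.
  by rewrite scale1r add_lfunE !comp_lfunE addE linearD.
have AW : ext0 A W by apply: contrapT => nAW; apply: nA; exists A, i, p.
have [h hP] := AW (fun a => z a \o i _)%VF.
exists (fun v => h v \o p v)%VF => a v; have := hP a (p _ v).
by rewrite !comp_lfunE hfun_nat.
Qed.

Lemma hom_summand V W (f : rhom V W) : f <> rzero V W ->
  exists A (i : rhom A W) (p : rhom W A),
    [/\ rcomp p i = id_hom A, indec A & rcomp p f <> rzero V A].
Proof.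
move=> f0; apply: contrapT => nA; apply: f0.
have -> : f = rcomp (id_hom W) f by apply: rhom_ext => i v; rewrite !rhomE.
apply: (@summand_ind _ (fun g => rcomp g f = rzero V W)) => [|g h g0 h0|A i p pi iA].
- by apply: rhom_ext => i v; rewrite !rhomE.
- apply: rhom_ext => i v; rewrite !rhomE -!(rcompE _ f) g0 h0 !rhomE.
  by rewrite addr0.
have pf0 : rcomp p f = rzero V A.
  by apply: contrapT => pf; apply: nA; exists A, i, p.
by apply: rhom_ext => v x; rewrite !rhomE -(rcompE p f) pf0 !rhomE linear0.
Qed.

(** Otherwise the projection of K to its summand A would extend to X, making A
    a retract of X, hence as large as X, although A lies in K and I is
    nonzero. *)
Lemma indec_ext_kernel K X I (m : rhom K X) (p : rhom X I)
    A (i : rhom A K) (q : rhom K A) :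
  short_exact m p -> indec X -> (0 < rdim I)%N ->
  rcomp q i = id_hom A -> indec A -> ~ ext0 I A.
Proof.
move=> mp [_ iX] I0 qi [A0 _] /(ext0_extend mp q) [g gm].
have gmi : rcomp g (rcomp m i) = id_hom A.
  by rewrite -qi -gm; apply: rhom_ext => v x; rewrite !rhomE.
have := iX _ _ _ gmi A0; have := inj_dim (retract_rinj qi).
by rewrite (exact_dim mp); lia.
Qed.

(** Otherwise the inclusion of A in C would lift to X, making A a retract of
    X, hence as large as X. *)
Lemma indec_ext_cokernel I X C (m : rhom I X) (p : rhom X C)
    A (i : rhom A C) (q : rhom C A) :
  short_exact m p -> indec X -> (0 < rdim I)%N ->
  rcomp q i = id_hom A -> indec A -> ~ ext0 A I.
Proof.
move=> mp [_ iX] I0 qi [A0 _] /(ext0_lift mp i) [g pg].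
have qpg : rcomp (rcomp q p) g = id_hom A.
  by rewrite -qi -pg; apply: rhom_ext => v x; rewrite !rhomE.
have := iX _ _ _ qpg A0; have := inj_dim (retract_rinj qi).
by rewrite (exact_dim mp); lia.
Qed.

(** * Walks of nonzero extensions *)

(** [walk U V d] stands for a walk V => ... => U of total dimension d, where
    the source V counts and the target U does not; thus d is additive under
    concatenation, and for closed walks it is the sum over one period. *)
Inductive walk U : rep k Q -> nat -> Prop :=
| Walk1 V of indec V & ~ ext0 V U : walk U V (rdim V)
| WalkS V W d of indec V & ~ ext0 V W & walk U W d : walk U V (rdim V + d).

Lemma walk_cat U V W d d' : walk V W d -> walk U V d' -> walk U W (d + d').
Proof.
elim=> [W' iW nW wV|W' X e iW nW _ IH wV]; first exact: WalkS iW nW wV.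
by rewrite -addnA; apply: WalkS iW nW (IH wV).
Qed.

(** Apply half exactness to the kernel K of p: if Ext^1(I, W) = 0 then
    Ext^1(K, W) <> 0, and the summand A of K that detects it satisfies I => A
    by [indec_ext_kernel]. *)
Lemma ext_quotient X I W (p : rhom X I) : rsurj p -> indec X -> indec I ->
  ~ ext0 X W -> ~ ext0 I W \/
  exists A, [/\ indec A, ~ ext0 I A, ~ ext0 A W & (rdim I + rdim A <= rdim X)%N].
Proof.
move=> ps iX iI nXW; have [IW|] := pselect (ext0 I W); [right|by left].
have [K [m mp]] := ex_kernel ps.
have : ~ ext0 K W by move=> KW; apply: nXW; exact (ext0_midl mp KW IW).
case/ext_summandl => A [i [q [qi iA nAW]]]; exists A; split=> //.
  by apply: indec_ext_kernel mp iX _ qi iA; case: iI.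
by rewrite (exact_dim mp) addnC leq_add2r (inj_dim (retract_rinj qi)).
Qed.

(** Dual of [ext_quotient], with the cokernel of m. *)
Lemma ext_subobject X I V (m : rhom I X) : rinj m -> indec X -> indec I ->
  ~ ext0 V X -> ~ ext0 V I \/
  exists A, [/\ indec A, ~ ext0 A I, ~ ext0 V A & (rdim I + rdim A <= rdim X)%N].
Proof.
move=> mi iX iI nVX; have [VI|] := pselect (ext0 V I); [right|by left].
have [C [p mp]] := ex_cokernel mi.
have : ~ ext0 V C by move=> VC; apply: nVX; exact (ext0_midr mp VI VC).
case/ext_summandr => A [i [q [qi iA nVA]]]; exists A; split=> //.
  by apply: indec_ext_cokernel mp iX _ qi iA; case: iI.
by rewrite (exact_dim mp) leq_add2l (inj_dim (retract_rinj qi)).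
Qed.

Lemma walk_quotient U X I (p : rhom X I) d :
  rsurj p -> indec I -> walk U X d -> exists2 d', walk U I d' & (d' <= d)%N.
Proof.
move=> + iI wX; case: X d / wX p => [X iX nXU|X W e iX nXW wW] p ps.
  have le := surj_dim ps.
  have [nI|[A [iA nIA nAU le']]] := ext_quotient ps iX iI nXU.
    by exists (rdim I); first exact: Walk1.
  by exists (rdim I + rdim A)%N => //; apply: WalkS iI nIA (Walk1 iA nAU).
have le := surj_dim ps.
have [nI|[A [iA nIA nAU le']]] := ext_quotient ps iX iI nXW.
  by exists (rdim I + e)%N; [exact: WalkS iI nI wW|lia].
exists (rdim I + (rdim A + e))%N; last lia.
exact: WalkS iI nIA (WalkS iA nAU wW).
Qed.

Lemma walk_sub V X I (m : rhom I X) d :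
  rinj m -> indec X -> indec I -> walk X V d ->
  exists2 d', walk I V d' & (d' + rdim I <= d + rdim X)%N.
Proof.
move=> mi iX iI; have le := inj_dim mi.
elim=> [W iW nWX|W W' e iW nWW' _ [d' wW' led']]; last first.
  by exists (rdim W + d')%N; [exact: WalkS iW nWW' wW'|lia].
have [nI|[A [iA nAI nWA le']]] := ext_subobject mi iX iI nWX.
  by exists (rdim W); [exact: Walk1|lia].
by exists (rdim W + rdim A)%N; [exact: WalkS iW nWA (Walk1 iA nAI)|lia].
Qed.

(** Route the walk through an indecomposable summand A of the image of f: its
    first object X is replaced by the quotient A, and its target Y by the
    subobject A. The second replacement saves dim A, which makes the bound
    strict. *)
Lemma walk_hom X Y (f : rhom X Y) d :
  indec Y -> f <> rzero X Y -> walk Y X d ->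
  exists A d', walk A A d' /\ (d' < d + rdim Y)%N.
Proof.
move=> iY f0 wXY; have [J [e [m [es mi em]]]] := ex_image f.
have e0 : e <> rzero X J.
  by move=> e0; apply: f0; rewrite -em e0; apply: rhom_ext => i v; rewrite !rhomE linear0.
have [A [i [p [pi iA _]]]] := hom_summand e0.
have [d1 w1 le1] := walk_quotient (rsurj_comp (retract_rsurj pi) es) iA wXY.
have [d2 w2 le2] := walk_sub (rinj_comp mi (retract_rinj pi)) iY iA w1.
by exists A, d2; split=> //; case: iA => A0 _; lia.
Qed.

(** Ringel's argument. Choose a nonzero, non-injective endomorphism of X whose
    image I has least dimension. This endomorphism has square 0, for otherwise
    minimality would make I a retract of X. So I lies in its kernel K and has a
    nonzero projection to some indecomposable summand A of K, injective again
    by minimality. Then I => A, and restriction from A to I is surjective on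
    Ext^1, so A => A. *)
Lemma nonbrick_self_ext X (f : rhom X X) : indec X -> f <> rzero X X -> ~ rinj f ->
  exists A, [/\ indec A, ~ ext0 A A & (rdim A < rdim X)%N].
Proof.
move=> iX f0 nf.
pose P r := `[< exists I (e : rhom X I) (m : rhom I X),
  [/\ rsurj e, rinj m, rdim I = r & (0 < r < rdim X)%N] >].
have exP : exists r, P r.
  have [I [e [m [es mi em]]]] := ex_image f.
  exists (rdim I); apply/asboolP; exists I, e, m; split=> //; apply/andP; split.
    apply: (@rdim_gt0 _ _ m) => m0; apply: f0; rewrite -em m0.
    by apply: rhom_ext => i v; rewrite !rhomE.
  rewrite ltn_neqAle (surj_dim es) andbT; apply/eqP => eI.
  by apply: nf; rewrite -em; apply: rinj_comp mi (surj_inj es _).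
case: (ex_minnP exP) => r /asboolP [I [e [m [es mi Ir /andP [r0 rX]]]]] minr.
have {minr} minI J (a : rhom X J) (b : rhom J X) : rsurj a -> rinj b ->
    (0 < rdim J)%N -> (rdim J <= rdim I)%N -> rdim J = rdim I.
  move=> as_ bi J0 JI; apply/eqP; rewrite eqn_leq JI Ir; apply: minr.
  by apply/asboolP; exists J, a, b; split=> //; lia.
(* The minimal endomorphism is m e, with square m (e m) e. *)
have em0 : rcomp e m = rzero I I.
  apply: contrapT => em0.
  have [J [a [b [as_ bi ba]]]] := ex_image (rcomp e m).
  have J0 : (0 < rdim J)%N.
    apply: (@rdim_gt0 _ _ b) => b0; apply: em0; rewrite -ba b0.
    by apply: rhom_ext => i v; rewrite !rhomE.
  have JI : rdim J = rdim I.
    by apply: minI (rsurj_comp as_ es) (rinj_comp mi bi) J0 (surj_dim as_).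
  have emi : rinj (rcomp e m).
    by rewrite -ba; apply: rinj_comp bi (surj_inj as_ _).
  have [g gem] := ex_inverse emi (inj_surj emi erefl).
  have gemI : rcomp (rcomp g e) m = id_hom I.
    by rewrite -gem; apply: rhom_ext => i v; rewrite !rhomE.
  by have := iX.2 _ _ _ gemI; lia.
have [K [c ce]] := ex_kernel es.
have [n cn] := factor_kernel ce em0.
have n0 : n <> rzero I K.
  move=> n0; have /rdim_eq0 : forall i (v : I i), v = 0; last by lia.
  by move=> i v; apply: mi; rewrite -cn n0 !rhomE !linear0.
have [A [i [p [pi iA pn0]]]] := hom_summand n0.
have [J [a [b [as_ bi ba]]]] := ex_image (rcomp p n).
have J0 : (0 < rdim J)%N.
  apply: (@rdim_gt0 _ _ b) => b0; apply: pn0; rewrite -ba b0.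
  by apply: rhom_ext => v x; rewrite !rhomE.
have [ci _ _] := ce.
have JI : rdim J = rdim I.
  apply: minI (rsurj_comp as_ es) _ J0 (surj_dim as_).
  exact: rinj_comp ci (rinj_comp (retract_rinj pi) bi).
have pni : rinj (rcomp p n) by rewrite -ba; apply: rinj_comp bi (surj_inj as_ _).
exists A; split=> //.
  move/(ext0_sub pni); apply: (indec_ext_kernel ce iX _ pi iA); lia.
have := inj_dim (retract_rinj pi); have := exact_dim ce; lia.
Qed.

End Indecomposables.

(** * The Euler form *)

Section Euler.
Variables (k : fieldType) (Q : quiver).
Implicit Types A B C I K T V W X Y : rep k Q.

(** Coordinates on a finite product of vector spaces of varying type, which
    makes rank-nullity available for maps between such products. *)
Lemma dprod_coord (J : finType) (T : J -> vectType k) :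
  exists (N : nat) (D : 'rV[k]_N -> forall j, T j),
    [/\ N = (\sum_j \dim {:T j})%N,
        forall c x y j, D (c *: x + y) j = c *: D x j + D y j,
        forall x y, (forall j, D x j = D y j) -> x = y
      & forall t, exists x, forall j, D x j = t j].
Proof.
pose S := {j : J & 'I_(\dim {:T j})}.
pose s j l : S := Tagged (fun j => 'I_(\dim {:T j})) (l : 'I_(\dim {:T j})).
pose b j := vbasis {:T j}.
pose D (x : 'rV[k]_#|{: S}|) j : T j := \sum_l x 0 (enum_rank (s j l)) *: (b j)`_l.
exists #|{: S}|, D; split.
- rewrite card_tagged sumnE big_map big_enum /=.
  by apply: eq_bigr => j _; rewrite card_ord.
- move=> c x y j; rewrite /D scaler_sumr -big_split /=.
  by apply: eq_bigr => l _; rewrite !mxE scalerDl scalerA.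
- move=> x y xy; apply/rowP => r; rewrite -[r]enum_valK.
  case: (enum_val r) => j l; have /(congr1 (coord (b j) l)) := xy j.
  by rewrite /D !coord_sum_free ?(basis_free (vbasisP _)).
move=> t; exists (\row_r coord (b (tag (enum_val r))) (tagged (enum_val r)) (t _)) => j.
rewrite [RHS](coord_vbasis (memvf _)); apply: eq_bigr => l _.
by rewrite mxE enum_rankK.
Qed.

Definition euler V W : int :=
  \sum_i (\dim {:V i} * \dim {:W i})%:Z
  - \sum_a (\dim {:V (src a)} * \dim {:W (tgt a)})%:Z.

Lemma dim_lfun (U V : vectType k) : \dim {:'Hom(U, V)} = (\dim {:U} * \dim {:V})%N.
Proof. by rewrite !dimvf. Qed.

(** Hom(V, W) and Ext^1(V, W) are the kernel and the cokernel of the map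
    h |-> W_a h - h V_a from the product of the Hom(V_i, W_i) to the product
    over the arrows, and <V, W> is the difference of the dimensions of these
    two products. Here b bounds dim Hom(V, W), spanned by g, and c is a lower
    bound of dim Ext^1(V, W). *)
Lemma euler_le V W (g : rhom V W) (b c : bool) :
  (forall f : rhom V W, exists a, forall i v, f i v = a *: g i v) ->
  (g <> rzero V W -> b) -> (c -> ~ ext0 V W) -> euler V W <= b%:Z - c%:Z.
Proof.
move=> gP gb cP.
have [N [D [NE Dlin Dinj Donto]]] := dprod_coord (fun i => 'Hom(V i, W i)).
have [M [G [ME Glin Ginj Gonto]]] :=
  dprod_coord (fun a => 'Hom(V (src a), W (tgt a))).
pose delta (h : forall i, 'Hom(V i, W i)) a : 'Hom(V (src a), W (tgt a)) :=
  ((rmap W a \o h _) - (h _ \o rmap V a))%VF.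
have deltaE h a v : delta h a v = rmap W a (h _ v) - h _ (rmap V a v).
  by rewrite add_lfunE opp_lfunE !comp_lfunE.
pose F x := sval (cid (Gonto (delta (D x)))).
have FP x a : G (F x) a = delta (D x) a by rewrite /F; case: cid.
have Flin : linear F.
  move=> a x y; apply: Ginj => l; rewrite Glin !FP; apply/lfunP => v.
  rewrite [RHS]add_lfunE scale_lfunE !deltaE !Dlin !(add_lfunE, scale_lfunE).
  by rewrite linearP /= scalerBr opprD addrACA.
have [f fF] := @lfun_of k 'rV[k]_N 'rV[k]_M F Flin.
have D0 i : D 0 i = 0.
  by have := Dlin (-1) 0 0 i; rewrite scaler0 addr0 scaleN1r addNr.
have G0 a : G 0 a = 0.
  by have := Glin (-1) 0 0 a; rewrite scaler0 addr0 scaleN1r addNr.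
have kerb : (\dim (lker f) <= b)%N.
  have [y yg] := Donto (fun i => g i).
  have kerg : (lker f <= <[y]>)%VS.
    apply/subvP => x; rewrite memv_ker fF => /eqP Fx0.
    have hn a v : D x (tgt a) (rmap V a v) = rmap W a (D x (src a) v).
      apply/eqP; rewrite eq_sym -subr_eq0 -deltaE -FP Fx0 G0.
      by rewrite zero_lfunE.
    have [a aP] := gP (RHom hn); apply/vlineP; exists a; apply: Dinj => i.
    rewrite -[a *: y]addr0 Dlin yg D0 addr0; apply/lfunP => v.
    by rewrite scale_lfunE -aP.
  apply: leq_trans (dimvS kerg) _; rewrite dim_vline.
  case: eqVneq => //= y0; rewrite lt0b; apply: gb => g0; case/eqP: y0.
  by apply: Dinj => i; rewrite yg g0 D0.
have imc : (\dim (limg f) + c <= M)%N.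
  have dimM : \dim {:'rV[k]_M} = M by rewrite dimvf /dim /= mul1n.
  case: c cP => [cP|_]; last by rewrite addn0 -[X in (_ <= X)%N]dimM dimvS ?subvf.
  rewrite addn1 -[X in (_ < X)%N]dimM ltn_neqAle dimvS ?subvf // andbT.
  apply/negP => e; apply: (cP isT) => z.
  have /eqP fe : limg f == fullv by rewrite eqEdim subvf (eqP e) /=.
  have [u uz] := Gonto z; have : u \in limg f by rewrite fe memvf.
  case/memv_imgP => x _; rewrite fF => ux; exists (D x) => a v.
  by rewrite -deltaE -FP -ux uz.
have dimN : \dim {:'rV[k]_N} = N by rewrite dimvf /dim /= mul1n.
have := limg_ker_dim f fullv; rewrite capfv dimN => fN.
have -> : euler V W = N%:Z - M%:Z.
  rewrite /euler NE ME !(big_morph Posz PoszD (erefl _)).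
  by congr (_ - _); apply: eq_bigr => ? _; rewrite dim_lfun.
lia.
Qed.
End Euler.

(** * Absence of closed walks *)

Lemma ex_eigenvector (k : closedFieldType) (U : vectType k) (f : 'End(U)) :
  (0 < \dim {:U})%N -> exists c v, v != 0 /\ f v = c *: v.
Proof.
move=> U0; pose e := vbasis {:U}; have eb : basis_of {:U} e := vbasisP _.
pose M := mxof e e f.
have [c] : exists c, root (char_poly M) c.
  by apply/closed_rootP; rewrite size_char_poly; case: (\dim _) U0.
rewrite -eigenvalue_root_char => /eigenvalueP [u uM u0].
exists c, (vecof e u); split; first by rewrite vecof_eq0.
by rewrite (hom_vecof e eb) -/M uM linearZ.
Qed.

Section ClosedWalks.
Variables (k : closedFieldType) (Q : quiver).
Implicit Types A B C I K T V W X Y : rep k Q.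

(** Subtracting an eigenvalue of f at one vertex gives an endomorphism that is
    not injective, hence zero. *)
Lemma endo_scalar X : indec X ->
  (forall f : rhom X X, f <> rzero X X -> rinj f) ->
  forall f : rhom X X, exists c, forall i v, f i v = c *: id_hom X i v.
Proof.
move=> [X0 _] brick f.
have [i Xi] : exists i, (0 < \dim {:X i})%N.
  apply: contrapT => nX; move: X0; rewrite lt0n => /eqP; apply.
  apply: big1 => i _; apply/eqP; rewrite -leqn0 leqNgt; apply/negP => Xi.
  by apply: nX; exists i.
have [c [v [v0 fv]]] := ex_eigenvector (f i) Xi; exists c.
pose g := rsub f (scale_hom X c).
have gE j w : g j w = f j w - c *: id_hom X j w.
  by rewrite rsubE /= scale_lfunE.
have g0 : g = rzero X X.
  apply: contrapT => /brick /(_ i v 0) gi; case/eqP: v0; apply: gi.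
  by rewrite linear0 gE fv idE subrr.
by move=> j w; apply/eqP; rewrite -subr_eq0 -gE g0 rzeroE.
Qed.

Lemma walk_seq U V d : walk U V d -> exists n (X : nat -> rep k Q),
  [/\ (0 < n)%N, X 0%N = V, X n = U,
      forall t, (t < n)%N -> indec (X t) /\ ~ ext0 (X t) (X t.+1)
    & d = (\sum_(0 <= t < n) rdim (X t))%N].
Proof.
elim=> [{}V iV nVU|{}V W e iV nVW _ [n [X [n0 X0 Xn Xt ->]]]].
  exists 1%N, (fun t => if t is 0 then V else U); split=> //.
    by case.
  by rewrite big_nat1.
exists n.+1, (fun t => if t is t'.+1 then X t' else V); split=> //.
  by case=> [_|t /Xt //]; rewrite X0.
by rewrite big_nat_recl.
Qed.

Lemma walk_of_seq (X : nat -> rep k Q) i j : (i < j)%N ->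
  (forall t, (t < j)%N -> indec (X t) /\ ~ ext0 (X t) (X t.+1)) ->
  walk (X j) (X i) (\sum_(i <= t < j) rdim (X t)).
Proof.
move=> ij Xt; elim: j ij Xt => // j IHj; rewrite ltnS leq_eqVlt.
have [<- _ Xt|ij /= ij' Xt] := eqVneq i j.
  by have [] := Xt i (ltnSn i); rewrite big_nat1; apply: Walk1.
rewrite big_nat_recr /=; last exact: ltnW.
have [iX nX] := Xt j (ltnSn j); apply: walk_cat (Walk1 iX nX).
by apply: IHj => // t tj; apply: Xt; apply: ltnW.
Qed.

Lemma sum_pred1 n (i : 'I_n) : \sum_(j < n) (j == i)%:Z = 1.
Proof. by rewrite (bigD1 i) //= eqxx big1 ?addr0 // => j /negPf ->. Qed.

Hypothesis tits_pos : forall x : vertex Q -> nat, (exists v, 0 < x v)%N ->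
  (\sum_a x (src a) * x (tgt a) < \sum_v x v * x v)%N.

Lemma sum_euler n (X : 'I_n -> rep k Q) : (exists i, 0 < rdim (X i))%N ->
  0 < \sum_(i < n) \sum_(j < n) euler (X i) (X j).
Proof.
move=> [i Xi]; pose x v := (\sum_(i < n) \dim {:X i v})%N.
have -> : \sum_(i < n) \sum_(j < n) euler (X i) (X j) =
    (\sum_v x v * x v)%N%:Z - (\sum_a x (src a) * x (tgt a))%N%:Z.
  have sumD (J : finType) (p q : J -> 'I_n -> nat) :
      \sum_i \sum_j \sum_l (p l i * q l j)%:Z
      = (\sum_l (\sum_i p l i) * (\sum_j q l j))%N%:Z.
    rewrite (big_morph Posz PoszD (erefl _)) exchange_big /=.
    under eq_bigr => j _ do rewrite exchange_big /=.
    rewrite exchange_big /=; apply: eq_bigr => l _.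
    rewrite big_distrlr /= (big_morph Posz PoszD (erefl _)) exchange_big.
    by apply: eq_bigr => j _; rewrite (big_morph Posz PoszD (erefl _)).
  rewrite -!sumD -sumrB; apply: eq_bigr => l _.
  by rewrite -sumrB.
rewrite subr_gt0 ltz_nat; apply: tits_pos.
apply: contrapT => nx; move: Xi; rewrite /rdim big1 // => v _.
apply/eqP; rewrite -leqn0 leqNgt; apply/negP => Xv; apply: nx; exists v.
by apply: leq_trans Xv _; rewrite /x (bigD1 i) //= leq_addr.
Qed.

(** Otherwise each <X_i, X_j> is at most [j = i] - [j = i + 1 mod n], and
    these bounds add up to 0. *)
Lemma cyclic_hom n (X : 'I_n -> rep k Q) : (0 < n)%N ->
  (forall i, indec (X i)) -> (forall i, ~ ext0 (X i) (X (ordS i))) ->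
  exists i j (f : rhom (X i) (X j)),
    f <> rzero _ _ /\ (i <> j \/ (i = j /\ ~ rinj f)).
Proof.
move=> n0 iX nX; apply: contrapT => no.
have scal i (f : rhom (X i) (X i)) : exists c, forall v x, f v x = c *: id_hom (X i) v x.
  apply: endo_scalar => // g g0; apply: contrapT => ng; apply: no.
  by exists i, i, g; split=> //; right.
have hom0 i j (f : rhom (X i) (X j)) : i <> j -> f = rzero _ _.
  move=> ij; apply: contrapT => f0; apply: no.
  by exists i, j, f; split=> //; left.
have : 0 < \sum_(i < n) \sum_(j < n) euler (X i) (X j).
  by apply: sum_euler; exists (Ordinal n0); have [] := iX (Ordinal n0).
suff : \sum_(i < n) \sum_(j < n) euler (X i) (X j)
       <= \sum_(i < n) \sum_(j < n) ((j == i)%:Z - (j == ordS i)%:Z).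
  by rewrite [X in _ <= X]big1 => [|i _]; [lia | rewrite sumrB !sum_pred1 subrr].
apply: ler_sum => i _; apply: ler_sum => j _.
have c : j == ordS i -> ~ ext0 (X i) (X j) by move/eqP => ->.
have [ij|ij] := eqVneq j i.
  by move: c; rewrite ij => c; apply: euler_le (scal i) _ c.
apply: (@euler_le _ _ _ _ (rzero _ _) false _ _ _ c) => // f; exists 0 => v x.
rewrite (hom0 i j f) ?rzeroE ?scaler0 //.
by apply/eqP; rewrite eq_sym.
Qed.

Lemma leq_sum_nat_sub (F : nat -> nat) a b c d : (c <= a)%N -> (a <= b)%N -> (b <= d)%N ->
  (\sum_(a <= t < b) F t <= \sum_(c <= t < d) F t)%N.
Proof.
move=> ca ab bd; rewrite (big_cat_nat (m := c) (n := a)) ?(leq_trans ab) //=.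
by rewrite [X in (_ <= _ + X)%N](big_cat_nat (n := b)) //= addnCA leq_addr.
Qed.

(** Induction on the total dimension d. A map X_i -> X_j with i <> j is
    fed into [walk_hom] with the stretch of the closed walk from X_i to X_j,
    which wraps around through X_n = X_0 when j < i. *)
Lemma no_closed_walk A d : ~ walk A A d.
Proof.
elim/ltn_ind: d A => d IH A wA.
have [n [X [n0 X0 Xn Xt dE]]] := walk_seq wA.
pose Y (i : 'I_n) := X i.
have YS i : ~ ext0 (Y i) (Y (ordS i)).
  have [_] := Xt i (ltn_ord i); rewrite /Y /=.
  have := ltn_ord i; rewrite leq_eqVlt => /orP [/eqP e|e].
    by rewrite e modnn Xn X0.
  by rewrite modn_small.
have Yi i : indec (Y i) by case: (Xt i (ltn_ord i)).
have [i [j [f [f0 []]]]] := cyclic_hom n0 Yi YS; last first.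
  move=> [ij]; case: j / ij f f0 => f f0 nf.
  have [B [iB nB BX]] := nonbrick_self_ext (Yi i) f0 nf.
  apply: (IH _ _ _ (Walk1 iB nB)); apply: leq_trans BX _.
  rewrite dE -[rdim (Y i)](big_nat1 addn i (fun t => rdim (X t))).
  exact: leq_sum_nat_sub.
move=> ij.
suff [e w le] : exists2 e, walk (Y j) (Y i) e & (e + rdim (Y j) <= d)%N.
  have [B [b [wB lb]]] := walk_hom (Yi j) f0 w.
  by apply: IH wB; apply: leq_trans lb le.
have Xle t : (t <= n)%N -> forall s, (s < t)%N -> indec (X s) /\ ~ ext0 (X s) (X s.+1).
  by move=> tn s st; apply: Xt; apply: leq_trans tn.
have [lij|lji|/val_inj //] := ltngtP i j.
  exists (\sum_(i <= t < j) rdim (X t))%N.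
    by apply: walk_of_seq lij (Xle _ (ltnW (ltn_ord j))).
  rewrite dE /Y -big_nat_recr /=; last exact: ltnW.
  by apply: leq_sum_nat_sub; rewrite ?(ltnW (leqW lij)).
have w1 := walk_of_seq (ltn_ord i) (Xle _ (leqnn n)).
have le : (\sum_(i <= t < n) rdim (X t) + \sum_(0 <= t < j.+1) rdim (X t) <= d)%N.
  rewrite dE addnC [leqRHS](big_cat_nat (n := i)) ?(ltnW (ltn_ord i)) //= leq_add2r.
  exact: leq_sum_nat_sub.
rewrite big_nat_recr //= addnA in le.
have [j0|j0] := posnP j.
  exists (\sum_(i <= t < n) rdim (X t))%N; first by rewrite /Y j0 X0 -Xn.
  by apply: leq_trans le; rewrite leq_add2r leq_addr.
have w2 := walk_of_seq j0 (Xle _ (ltnW (ltn_ord j))).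
exists (\sum_(i <= t < n) rdim (X t) + \sum_(0 <= t < j) rdim (X t))%N => //.
by apply: walk_cat w2; rewrite X0 -Xn.
Qed.

End ClosedWalks.

(** * Positivity of the Tits form of a Dynkin graph *)

Section TitsForm.
Implicit Types (x y z : nat -> rat) (r : nat -> nat -> bool).

(** The part of the Tits form carried by the m edges of a path
    0 - 1 - ... - m, without the square of the end vertex m, which several arms share. *)
Definition arm m x : rat := \sum_(i < m) (x i ^+ 2 - x i * x i.+1).

Lemma armS m x : arm m.+1 x = arm m x + (x m ^+ 2 - x m * x m.+1).
Proof. by rewrite /arm big_ord_recr. Qed.

(** For a given end value t = x_m the minimum of an arm is - m t^2 / (2 (m + 1)).
    The induction step from m to m + 1 completes the square of
    (m + 2) x_m - (m + 1) x_(m+1). *)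
Lemma arm_ge m x : 0 <= 2 * m.+1%:R * arm m x + m%:R * x m ^+ 2.
Proof.
elim: m => [|m IHm]; first by rewrite /arm big_ord0 !mul0r mulr0 addr0.
have m0 : 0 <= m%:R :> rat by [].
rewrite armS; move: IHm; rewrite -!natr1; set M := m%:R in m0 *.
set F := arm m x; set a := x m; set b := x m.+1 => IHm.
suff : 0 <= (M + 1) * (2 * (M + 1 + 1) * (F + (a ^+ 2 - a * b)) + (M + 1) * b ^+ 2).
  by rewrite pmulr_rge0 //; lra.
have -> : (M + 1) * (2 * (M + 1 + 1) * (F + (a ^+ 2 - a * b)) + (M + 1) * b ^+ 2)
   = (M + 2) * (2 * (M + 1) * F + M * a ^+ 2)
     + ((M + 2) * a - (M + 1) * b) ^+ 2 by ring.
by rewrite addr_ge0 ?sqr_ge0 // mulr_ge0 //; lra.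
Qed.

Lemma arm_end0 m x : arm m x + x m ^+ 2 <= 0 -> x m = 0.
Proof.
have m0 : 0 <= m%:R :> rat by [].
move: (arm_ge m x); rewrite -natr1; set M := m%:R in m0 *.
set F := arm m x => ge le; apply/eqP; rewrite -sqrf_eq0 eq_le sqr_ge0 andbT.
have : (2 * (M + 1)) * (F + x m ^+ 2) <= 0 by apply: mulr_ge0_le0 => //; lra.
move=> h; have : (M + 2) * x m ^+ 2 <= 0 by lra.
by rewrite pmulr_rle0 //; lra.
Qed.

Lemma arm_eq0 m x : x m = 0 -> arm m x <= 0 -> forall i, (i <= m)%N -> x i = 0.
Proof.
elim: m => [|m IHm] xm le i; first by rewrite leqn0 => /eqP ->.
rewrite leq_eqVlt => /orP [/eqP -> //|im].
move: le; rewrite armS xm mulr0 subr0 => le; have a0 := arm_end0 le.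
by apply: (IHm a0 _ _ im); move: le; rewrite a0 expr0n /= addr0.
Qed.

Lemma sum_path n N z : (N <= n)%N ->
  \sum_(i < n) \sum_(j < n) ((i.+1 == j) && (j < N))%N%:R * (z i * z j)
  = \sum_(i < N.-1) z i * z i.+1 :> rat.
Proof.
move=> Nn; have le : (N.-1 <= n)%N by lia.
rewrite (big_ord_widen n (fun i => z i * z i.+1) le) [RHS]big_mkcond /=.
apply: eq_bigr => i _; case: ifP => iN.
  have in' : (i.+1 < n)%N by lia.
  rewrite (bigD1 (Ordinal in')) //= eqxx /= big1 ?addr0 => [|j].
    by rewrite (_ : (i.+1 < N)%N) ?mul1r //; lia.
  rewrite -val_eqE /= eq_sym => /negPf ->; exact: mul0r.
by rewrite big1 // => j _; case: andP => [[/eqP]|]; rewrite ?mul0r //; lia.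
Qed.

Lemma sum_edge n c d z : (c < n)%N -> (d < n)%N ->
  \sum_(i < n) \sum_(j < n) ((i == c :> nat) && (j == d :> nat))%:R * (z i * z j)
  = z c * z d :> rat.
Proof.
move=> cn dn; rewrite (bigD1 (Ordinal cn)) //= eqxx /= [X in _ + X]big1 ?addr0.
  rewrite (bigD1 (Ordinal dn)) //= eqxx mul1r big1 ?addr0 // => j.
  by rewrite -val_eqE /= => /negPf ->; rewrite mul0r.
move=> i; rewrite -val_eqE /= => /negPf ->.
by rewrite big1 // => j _; rewrite mul0r.
Qed.

(** For a quiver whose underlying graph is [undirected r] with r i j only for
    i < j, this says that the Tits form is positive definite. *)
Definition posdef n r : Prop := forall z, (exists2 i, (i < n)%N & z i != 0) ->
  \sum_(i < n) \sum_(j < n) (r i j)%:R * (z i * z j) < \sum_(i < n) z i ^+ 2.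

Lemma posdefA n : (0 < n)%N -> posdef n (fun i j => i.+1 == j).
Proof.
case: n => // m _ z [i im zi].
have -> : \sum_(i < m.+1) \sum_(j < m.+1) (i.+1 == j)%:R * (z i * z j)
          = \sum_(i < m) z i * z i.+1.
  rewrite -(sum_path z (leqnn m.+1)); apply: eq_bigr => a _; apply: eq_bigr => b _.
  by rewrite ltn_ord andbT.
rewrite big_ord_recr -subr_gt0 -addrAC -sumrB -/(arm m z) /=.
rewrite ltNge; apply/negP => le; have z0 := arm_end0 le.
by case/eqP: zi; apply: (@arm_eq0 m z z0 _ i im); move: le; rewrite z0 expr0n addr0.
Qed.

(** Three arms with c, m and 1 edges meet at the vertex c: the vertices below
    c, those from c + 1 to c + m in reverse order, and the vertex c + m + 1.
    Minimising each arm leaves v^2 times 1 - c / (2 (c + 1)) - m / (2 (m + 1))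
    - 1 / 4 for the value v at c. This is positive exactly under the
    hypothesis, which is 1 / (c + 1) + 1 / (m + 1) + 1 / 2 > 1 cleared of
    denominators. *)
Lemma posdef_star c m : (c * m < c + m + 3)%N ->
  posdef (c + m).+2 (fun i j => (i.+1 == j) && (j < (c + m).+1)
                             || (i == c) && (j == (c + m).+1))%N.
Proof.
move=> cm z [i im zi].
pose u t := z (c + m - t)%N; pose w := z (c + m).+1; pose v := z c.
have um : u m = v by rewrite /u addnK.
have -> : \sum_(i < (c + m).+2) \sum_(j < (c + m).+2)
    ((i.+1 == j) && (j < (c + m).+1) || (i == c :> nat) && (j == (c + m).+1 :> nat))%N%:R
      * (z i * z j) = \sum_(i < c + m) z i * z i.+1 + v * w.
  rewrite /v /w -(sum_path z (leqnSn (c + m).+1)).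
  rewrite -(@sum_edge (c + m).+2 c (c + m).+1 z) //; last first.
    by rewrite ltnS leqW ?leq_addr.
  rewrite -big_split; apply: eq_bigr => a _; rewrite -big_split; apply: eq_bigr => b _ /=.
  rewrite -mulrDl; congr (_ * _); case: eqVneq => //= _; rewrite ?add0r //.
  case: ltngtP; rewrite ?andbF ?andbT ?orbF ?addr0 //.
  by case: eqVneq; rewrite ?add0r.
have armu : arm m u = \sum_(i < m) (z (c + i).+1 ^+ 2 - z (c + i) * z (c + i).+1).
  rewrite /arm (reindex_inj rev_ord_inj) /=; apply: eq_bigr => a _.
  have am := ltn_ord a; rewrite /u.
  have -> : (c + m - (m - a.+1) = (c + a).+1)%N by lia.
  have -> : (c + m - (m - a.+1).+1 = c + a)%N by lia.
  by rewrite [z (c + a)%N * _]mulrC.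
have -> : \sum_(i < (c + m).+2) z i ^+ 2 =
    \sum_(i < c) z i ^+ 2 + v ^+ 2 + \sum_(i < m) z (c + i).+1 ^+ 2 + w ^+ 2.
  rewrite /w big_ord_recr /= -addnS big_split_ord big_ord_recl /= addn0 !addrA.
  by congr (_ + _ + _); apply: eq_bigr => a _; rewrite /= addnS.
rewrite big_split_ord /= -subr_gt0.
have regroup (a a' b b' v2 w2 vw : rat) :
  a + v2 + b + w2 - (a' + b' + vw) = (a - a') + (b - b') + (w2 - vw) + v2 by ring.
rewrite regroup.
rewrite -!sumrB -armu -/(arm c z).
rewrite ltNge; apply/negP => le.
have gc := arm_ge c z; have gm := arm_ge m u; rewrite um -/v in gc gm.
have v0 : v = 0.
  apply/eqP; rewrite -sqrf_eq0 eq_le sqr_ge0 andbT.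
  have gw : 0 <= (2 * w - v) ^+ 2 := sqr_ge0 _.
  move: cm; rewrite -(ltr_nat rat) !(natrD, natrM) => cm.
  rewrite -!natr1 in gc gm.
  have c0 : 0 <= c%:R :> rat by []. have m0 : 0 <= m%:R :> rat by [].
  set C := c%:R in c0 gc cm; set M := m%:R in m0 gm cm.
  set F := arm c z in le gc; set G := arm m u in le gm; set V := v ^+ 2.
  (* The form times 4 (C + 1) (M + 1) is the sum of the right-hand sides of h1,
     h2 and h3 plus (3 + C + M - C M) v^2. *)
  have h1 : 0 <= 2 * (M + 1) * (2 * (C + 1) * F + C * V).
    by rewrite !mulr_ge0 //; lra.
  have h2 : 0 <= 2 * (C + 1) * (2 * (M + 1) * G + M * V).
    by rewrite !mulr_ge0 //; lra.
  have h3 : 0 <= (C + 1) * (M + 1) * (2 * w - v) ^+ 2.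
    by apply: mulr_ge0 gw; apply: mulr_ge0; lra.
  have h4 : 4 * ((C + 1) * (M + 1)) * (F + G + (w ^+ 2 - v * w) + V) <= 0.
    by apply: mulr_ge0_le0 => //; rewrite !mulr_ge0 //; lra.
  have : (3 + C + M - C * M) * V <= 0 by rewrite /V in h1 h2 h4 *; lra.
  by rewrite pmulr_rle0 //; lra.
have w2 : 0 <= w ^+ 2 := sqr_ge0 w.
move: gc gm le; rewrite v0 mul0r expr0n /= !mulr0 subr0 !addr0 => gc gm le.
have ac : 0 <= arm c z by move: gc; rewrite pmulr_rge0 ?mulr_gt0.
have am : 0 <= arm m u by move: gm; rewrite pmulr_rge0 ?mulr_gt0.
have zc : forall j, (j <= c)%N -> z j = 0 by apply: arm_eq0 => //; lra.
have uc : forall j, (j <= m)%N -> u j = 0 by apply: arm_eq0; [rewrite um|lra].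
case/eqP: zi; case: (leqP i c) => [/zc //|ci].
have [e|ie] := eqVneq i (c + m).+1.
  rewrite e -/w; apply/eqP; rewrite -sqrf_eq0 eq_le w2 andbT; lra.
have := uc (c + m - i)%N; rewrite /u subKn; last by lia.
by apply; lia.
Qed.

End TitsForm.

(** Each arrow is counted once for either order of its two distinct ends. *)
Lemma sum_nedges (Q : quiver) (x : vertex Q -> nat) :
  (forall u : vertex Q, nedges u u = 0%N) ->
  (\sum_u \sum_v nedges u v * (x u * x v) = 2 * \sum_a x (src a) * x (tgt a))%N.
Proof.
move=> loop0.
have st (a : arrow Q) : src a != tgt a.
  apply/eqP => e; have /eqP := loop0 (src a); rewrite cards_eq0 => /eqP/setP/(_ a).
  by rewrite !inE -e !eqxx.
have sum1 p q : (\sum_u \sum_v ((p == u) && (q == v)) * (x u * x v) = x p * x q)%N.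
  rewrite (bigD1 p) //= [X in (_ + X)%N]big1 ?addn0 => [|u /negPf up]; last first.
    by apply: big1 => v _; rewrite eq_sym up.
  rewrite (bigD1 q) //= big1 ?addn0 ?eqxx ?mul1n // => v /negPf vq.
  by rewrite eq_sym vq andbF.
rewrite mulnC big_distrl /=.
transitivity (\sum_a \sum_u \sum_v
    (((src a == u) && (tgt a == v)) + ((tgt a == u) && (src a == v))) * (x u * x v))%N.
  rewrite [RHS]exchange_big /=; apply: eq_bigr => u _.
  rewrite [RHS]exchange_big /=; apply: eq_bigr => v _.
  rewrite -big_distrl /=; congr (_ * _)%N.
  rewrite /nedges -sum1_card big_mkcond /=; apply: eq_bigr => a _; rewrite inE.
  rewrite [(tgt a == u) && _]andbC.
  have [/andP [/eqP <- /eqP <-]|_] := boolP ((src a == u) && (tgt a == v)).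
    by rewrite (negPf (st a)).
  by case: (_ && _).
apply: eq_bigr => a _; under eq_bigr => u _.
  under eq_bigr => v _ do rewrite mulnDl.
  rewrite big_split /=; over.
by rewrite big_split /= !sum1 [(x (tgt a) * _)%N]mulnC muln2 addnn.
Qed.

Lemma posdef_tits (Q : quiver) n (r : nat -> nat -> bool) (f : vertex Q -> 'I_n) :
  (forall i j, r i j -> (i < j)%N) -> posdef n r -> bijective f ->
  (forall u v, nedges u v = undirected r (f u) (f v)) ->
  forall x : vertex Q -> nat, (exists v, 0 < x v)%N ->
  (\sum_a x (src a) * x (tgt a) < \sum_v x v * x v)%N.
Proof.
move=> rlt pos [g fK gK] ne x [v0 xv0].
have rirr i : r i i = false by apply/negP => /rlt; rewrite ltnn.
have fb : {on predT, bijective g} by apply: onW_bij; exists f.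
pose z t : rat := oapp (fun i => (x (g i))%:R) 0 (insub t : option 'I_n).
have zE (i : 'I_n) : z i = (x (g i))%:R by rewrite /z valK.
rewrite -(ltr_nat rat) -(ltr_pM2l (_ : 0 < 2%:R)) // -natrM.
rewrite -sum_nedges => [|u]; last by rewrite ne /undirected rirr.
have /pos : exists2 i, (i < n)%N & z i != 0.
  exists (f v0) => //; rewrite zE fK pnatr_eq0 -lt0n //.
have -> : \sum_(i < n) z i ^+ 2 = (\sum_v x v * x v)%N%:R.
  rewrite natr_sum (reindex g) //=; apply: eq_bigr => i _.
  by rewrite zE natrM expr2.
move=> lt; rewrite -(ltr_pM2l (_ : 0 < 2%:R)) // in lt; apply: le_lt_trans lt.
rewrite natr_sum (reindex g) //= le_eqVlt; apply/orP; left; apply/eqP.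
transitivity (\sum_(i < n) \sum_(j < n) (r i j)%:R * (z i * z j)
   + \sum_(i < n) \sum_(j < n) (r j i)%:R * (z i * z j)).
  rewrite -big_split; apply: eq_bigr => i _ /=; rewrite -big_split /=.
  rewrite natr_sum (reindex g) //=; apply: eq_bigr => j _.
  rewrite ne !gK natrM natrM -!zE -mulrDl; congr (_ * _).
  rewrite /undirected; have [rij|] := boolP (r i j); last by rewrite add0r.
  rewrite /= (_ : r j i = false) ?addr0 //; apply/negP => /rlt; have := rlt _ _ rij.
  by lia.
rewrite [X in _ + X]exchange_big /= mulr_natl mulr2n; congr (_ + _).
by apply: eq_bigr => i _; apply: eq_bigr => j _; rewrite [z i * _]mulrC.
Qed.

(** D_n is the star with arms of n - 3, 1 and 1 edges, and E_n the star with
    arms of 2, n - 4 and 1 edges. *)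
Lemma dynkin_tits (Q : quiver) : dynkin Q -> forall x : vertex Q -> nat,
  (exists v, 0 < x v)%N -> (\sum_a x (src a) * x (tgt a) < \sum_v x v * x v)%N.
Proof.
case=> n [e [de [f [fbij ne]]]].
case: n e / de f fbij ne => n hn f fbij ne.
- by apply: posdef_tits (posdefA hn) fbij ne => i j /eqP <-.
- apply: posdef_tits (_ : posdef n _) fbij ne => [i j|]; first by lia.
  have := @posdef_star (n - 3) 1; have -> : ((n - 3 + 1).+2 = n)%N by lia.
  have -> : ((n - 3 + 1).+1 = n.-1)%N by lia.
  by apply; lia.
apply: posdef_tits (_ : posdef n _) fbij ne => [i j|]; first by lia.
have := @posdef_star 2 (n - 4); have -> : ((2 + (n - 4)).+2 = n)%N by lia.
have -> : ((2 + (n - 4)).+1 = n.-1)%N by lia.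
by apply; lia.
Qed.

(** An idempotent of End(V) = k is 0 or 1. *)
Lemma exceptional_indec (k : fieldType) (Q : quiver) (V : rep k Q) :
  exceptional V -> indec V.
Proof.
case=> brick _; split.
  rewrite lt0n; apply/eqP => /rdim0 V0; have [c [_ u]] := brick (rzero V V).
  have h a : forall i v, rzero V V i v = a *: v.
    by move=> i v; rewrite (V0 i v) scaler0 linear0.
  by have /eqP := u 0 (h 0); rewrite (u 1 (h 1)) oner_eq0.
move=> A i p pi A0; have [c [cP _]] := brick (rcomp i p).
have ip v x : c *: i v x = i v x by rewrite -cP rcompE (retractK pi).
have c1 : c = 1.
  apply: contrapT => /eqP c1; move: A0; rewrite lt0n => /eqP; apply.
  apply: rdim_eq0 => v x; apply: (retract_rinj pi); rewrite linear0.
  have /eqP := ip v x; rewrite -subr_eq0 -{2}[i v x]scale1r -scalerBl scaler_eq0.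
  by rewrite subr_eq0 (negPf c1) => /eqP.
apply/eqP; rewrite eqn_leq (inj_dim (retract_rinj pi)) /=; apply: (surj_dim (f := i)).
by move=> v x; exists (p v x); rewrite -(rcompE i p) cP c1 scale1r.
Qed.

Theorem corollary3p2 (k : closedFieldType) (Q : quiver) (hQ : dynkin Q) :
  (~ exists V W : rep k Q, ext_nontrivial_couple V W) /\
  (forall V W : rep k Q, exceptional V -> exceptional W ->
     hom1 V W = 0%N \/ hom1 W V = 0%N).
Proof.
have no V W : @exceptional k Q V -> exceptional W ->
    hom1 V W <> 0%N -> hom1 W V <> 0%N -> False.
  move=> /exceptional_indec iV /exceptional_indec iW hVW hWV.
  have nVW : ~ ext0 V W by move/ext0_hom1.
  have nWV : ~ ext0 W V by move/ext0_hom1.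
  (* The closed walk V => W => V. *)
  exact: (no_closed_walk (dynkin_tits hQ) (WalkS iV nVW (Walk1 iW nWV))).
split=> [[V [W [eV eW]]]|V W eV eW]; first exact: no.
have [|h1] := eqVneq (hom1 V W) 0%N; first by left.
have [|h2] := eqVneq (hom1 W V) 0%N; first by right.
by case: (no V W eV eW); apply/eqP.
Qed.
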